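(* The solution $$h(u,v)=\frac{3}{2\sinh^2\left(\frac{\sqrt3}{2}(u+v)\right)}+1$$ of the \c{T}i\c{t}eica PDE $(\ln h)_{uv}=h-\frac1{h^2}$ gives a \c{T}i\c{t}eica surface of revolution. Moreover, there is a ruled \c{T}i\c{t}eica surface associated to it: the function $H=h-1$ is a solution of the Liouville-\c{T}i\c{t}eica PDE $(\ln H)_{uv}=H$, and thus defines a ruled \c{T}i\c{t}eica surface.
   Context: A \c{T}i\c{t}eica surface is a surface in $\mathbb{R}^3$ for which $K/d^4$ is constant, where $K$ is the Gaussian curvature and $d$ the distance from the origin to the tangent plane at an arbitrary point. Let $\mathbf r(u,v)=(x(u,v),y(u,v),z(u,v))$ be the position vector, with $\det(\mathbf r,\mathbf r_u,\mathbf r_v)\neq0$. A solution $h$ of the \c{T}i\c{t}eica PDE gives the (non-ruled) \c{T}i\c{t}eica surface, determined up to a centroaffine transformation (invertible linear map of $\mathbb{R}^3$), whose coordinates $x,y,z$ are three linearly independent solutions of the completely integrable system $\mathbf r_{uu}=\frac{h_u}{h}\mathbf r_u+\frac1h\mathbf r_v$, $\mathbf r_{uv}=h\mathbf r$, $\mathbf r_{vv}=\frac1h\mathbf r_u+\frac{h_v}{h}\mathbf r_v$. It is a surface of revolution in the sense that the three independent solutions can be chosen so that the resulting surface is one of revolution. A solution $H$ of the Liouville-\c{T}i\c{t}eica PDE defines ruled \c{T}i\c{t}eica surfaces through the completely integrable system $\mathbf r_{uu}=\frac{H_u}{H}\mathbf r_u+\frac{\varphi(u)}{H}\mathbf r_v$,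 $\mathbf r_{uv}=H\mathbf r$, $\mathbf r_{vv}=\frac{H_v}{H}\mathbf r_v$, where $\varphi$ is a function of $u$. The functions are considered where $u+v\neq0$. *)

(* Defs.v *)
From Stdlib Require Import Reals.
From Coquelicot Require Import Coquelicot.

Open Scope R_scope.

(** * Vectors of R^3 *)

Record vec3 := Vec3 { vx : R; vy : R; vz : R }.

Definition vadd (a b : vec3) : vec3 :=
  Vec3 (vx a + vx b) (vy a + vy b) (vz a + vz b).

Definition vscal (k : R) (a : vec3) : vec3 :=
  Vec3 (k * vx a) (k * vy a) (k * vz a).

Definition dot (a b : vec3) : R := vx a * vx b + vy a * vy b + vz a * vz b.

Definition vnorm (a : vec3) : R := sqrt (dot a a).

Definition cross (a b : vec3) : vec3 :=
  Vec3 (vy a * vz b - vz a * vy b)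
       (vz a * vx b - vx a * vz b)
       (vx a * vy b - vy a * vx b).

Definition det3 (a b c : vec3) : R := dot a (cross b c).

Definition orthonormal (a b c : vec3) : Prop :=
  dot a a = 1 /\ dot b b = 1 /\ dot c c = 1 /\
  dot a b = 0 /\ dot a c = 0 /\ dot b c = 0.

(** * Partial derivatives and the coordinate domain *)

Definition D1 (f : R -> R -> R) : R -> R -> R :=
  fun u v => Derive (fun t => f t v) u.

Definition D2 (f : R -> R -> R) : R -> R -> R :=
  fun u v => Derive (fun t => f u t) v.

(** Used only on open sets [D], where [ex_diff_n _ 2] at every point means
    that [f] is of class C^2. *)
Definition C2_on (D : R -> R -> Prop) (f : R -> R -> R) : Prop :=
  forall u v, D u v -> ex_diff_n f 2 u v.

Definition uv_domain (u v : R) : Prop := u + v <> 0.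

Definition uv_domain_pos (u v : R) : Prop := 0 < u + v.
Definition uv_domain_neg (u v : R) : Prop := u + v < 0.

(** The domain [u + v <> 0] is disconnected.  Linear independence of solutions,
    uniqueness up to a linear map and constancy of K/d^4 are meaningful on
    connected domains, so surfaces are parametrized by one of the two
    components. *)
Definition is_component (D : R -> R -> Prop) : Prop :=
  D = uv_domain_pos \/ D = uv_domain_neg.

(** * The two partial differential equations *)

(** Positivity is what makes [ln h] meaningful ([ln] is total here). *)
Definition titeica_PDE (D : R -> R -> Prop) (h : R -> R -> R) : Prop :=
  C2_on D h /\
  forall u v, D u v ->
    0 < h u v /\
    D2 (D1 (fun u v => ln (h u v))) u v = h u v - 1 / (h u v) ^ 2.

Definition liouville_titeica_PDE (D : R -> R -> Prop) (H : R -> R -> R) : Prop :=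
  C2_on D H /\
  forall u v, D u v ->
    0 < H u v /\
    D2 (D1 (fun u v => ln (H u v))) u v = H u v.

(** * Surfaces *)

Definition coord_x (r : R -> R -> vec3) : R -> R -> R := fun u v => vx (r u v).
Definition coord_y (r : R -> R -> vec3) : R -> R -> R := fun u v => vy (r u v).
Definition coord_z (r : R -> R -> vec3) : R -> R -> R := fun u v => vz (r u v).

Definition vD1 (r : R -> R -> vec3) : R -> R -> vec3 :=
  fun u v => Vec3 (D1 (coord_x r) u v) (D1 (coord_y r) u v) (D1 (coord_z r) u v).

Definition vD2 (r : R -> R -> vec3) : R -> R -> vec3 :=
  fun u v => Vec3 (D2 (coord_x r) u v) (D2 (coord_y r) u v) (D2 (coord_z r) u v).

Definition unit_normal (r : R -> R -> vec3) (u v : R) : vec3 :=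
  let n := cross (vD1 r u v) (vD2 r u v) in vscal (/ vnorm n) n.

(** [(L N - M^2) / (E G - F^2)] *)
Definition gauss_curvature (r : R -> R -> vec3) (u v : R) : R :=
  let n := unit_normal r u v in
  (dot (vD1 (vD1 r) u v) n * dot (vD2 (vD2 r) u v) n
     - dot (vD2 (vD1 r) u v) n ^ 2)
  / (dot (vD1 r u v) (vD1 r u v) * dot (vD2 r u v) (vD2 r u v)
     - dot (vD1 r u v) (vD2 r u v) ^ 2).

Definition tangent_plane (r : R -> R -> vec3) (u v : R) (p : vec3) : Prop :=
  exists a b : R,
    p = vadd (r u v) (vadd (vscal a (vD1 r u v)) (vscal b (vD2 r u v))).

Definition dist_origin (S : vec3 -> Prop) : R :=
  real (Glb_Rbar (fun t => exists p, S p /\ t = vnorm p)).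

Definition titeica_surface (D : R -> R -> Prop) (r : R -> R -> vec3) : Prop :=
  C2_on D (coord_x r) /\ C2_on D (coord_y r) /\ C2_on D (coord_z r) /\
  (forall u v, D u v -> det3 (r u v) (vD1 r u v) (vD2 r u v) <> 0) /\
  exists c : R, forall u v, D u v ->
    gauss_curvature r u v / dist_origin (tangent_plane r u v) ^ 4 = c.

Definition image (D : R -> R -> Prop) (r : R -> R -> vec3) (p : vec3) : Prop :=
  exists u v, D u v /\ p = r u v.

Definition itv (a b : Rbar) (s : R) : Prop := Rbar_lt a s /\ Rbar_lt s b.

Definition C1_on_itv (a b : Rbar) (f : R -> R) : Prop :=
  forall s, itv a b s -> ex_derive f s /\ continuous (Derive f) s.

Definition C2_on_itv (a b : Rbar) (f : R -> R) : Prop :=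
  C1_on_itv a b f /\ C1_on_itv a b (Derive f).

(** The image is swept out by rotating the regular plane curve
    [s |-> o + f(s) e1 + g(s) e3] about the line through [o] directed by [e3],
    which the curve does not meet. *)
Definition surface_of_revolution
    (D : R -> R -> Prop) (r : R -> R -> vec3) : Prop :=
  exists (o e1 e2 e3 : vec3) (a b : Rbar) (f g : R -> R),
    orthonormal e1 e2 e3 /\
    Rbar_lt a b /\
    C2_on_itv a b f /\ C2_on_itv a b g /\
    (forall s, itv a b s ->
       0 < f s /\ (Derive f s <> 0 \/ Derive g s <> 0)) /\
    forall p : vec3,
      image D r p <->
      exists s theta : R, itv a b s /\
        p = vadd o (vadd (vscal (f s * cos theta) e1)
                         (vadd (vscal (f s * sin theta) e2)
                               (vscal (g s) e3))).

(** The image is swept out by a one-parameter family of straight lines, each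
    restricted to a common open parameter interval [(c, d)]: over a component of
    the domain the rulings need not be complete lines. *)
Definition ruled_surface (D : R -> R -> Prop) (r : R -> R -> vec3) : Prop :=
  exists (a b c d : Rbar) (alpha w : R -> vec3),
    Rbar_lt a b /\ Rbar_lt c d /\
    C1_on_itv a b (fun t => vx (alpha t)) /\
    C1_on_itv a b (fun t => vy (alpha t)) /\
    C1_on_itv a b (fun t => vz (alpha t)) /\
    C1_on_itv a b (fun t => vx (w t)) /\
    C1_on_itv a b (fun t => vy (w t)) /\
    C1_on_itv a b (fun t => vz (w t)) /\
    (forall t, itv a b t -> w t <> Vec3 0 0 0) /\
    forall p : vec3,
      image D r p <->
      exists t l : R, itv a b t /\ itv c d l /\
        p = vadd (alpha t) (vscal l (w t)).

(** * The linear systems and the surfaces they define *)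

Definition titeica_system
    (D : R -> R -> Prop) (h : R -> R -> R) (x : R -> R -> R) : Prop :=
  C2_on D x /\
  forall u v, D u v ->
    D1 (D1 x) u v = D1 h u v / h u v * D1 x u v + 1 / h u v * D2 x u v /\
    D2 (D1 x) u v = h u v * x u v /\
    D2 (D2 x) u v = 1 / h u v * D1 x u v + D2 h u v / h u v * D2 x u v.

Definition ruled_titeica_system
    (D : R -> R -> Prop) (phi : R -> R) (H : R -> R -> R) (x : R -> R -> R) : Prop :=
  C2_on D x /\
  forall u v, D u v ->
    D1 (D1 x) u v = D1 H u v / H u v * D1 x u v + phi u / H u v * D2 x u v /\
    D2 (D1 x) u v = H u v * x u v /\
    D2 (D2 x) u v = D2 H u v / H u v * D2 x u v.

Definition lin_indep (D : R -> R -> Prop) (x y z : R -> R -> R) : Prop :=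
  forall a b c : R,
    (forall u v, D u v -> a * x u v + b * y u v + c * z u v = 0) ->
    a = 0 /\ b = 0 /\ c = 0.

Definition independent_solutions (D : R -> R -> Prop)
    (sys : (R -> R -> R) -> Prop) (r : R -> R -> vec3) : Prop :=
  sys (coord_x r) /\ sys (coord_y r) /\ sys (coord_z r) /\
  lin_indep D (coord_x r) (coord_y r) (coord_z r).

Definition defined_by (D : R -> R -> Prop) (h : R -> R -> R)
    (r : R -> R -> vec3) : Prop :=
  independent_solutions D (titeica_system D h) r.

Definition ruled_defined_by (D : R -> R -> Prop) (phi : R -> R) (H : R -> R -> R)
    (r : R -> R -> vec3) : Prop :=
  independent_solutions D (ruled_titeica_system D phi H) r.

(** The invertible linear map has columns [a], [b], [c]. *)
Definition centroaffine_equivalent (D : R -> R -> Prop)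
    (r r' : R -> R -> vec3) : Prop :=
  exists a b c : vec3, det3 a b c <> 0 /\
    forall u v, D u v ->
      r' u v = vadd (vscal (vx (r u v)) a)
                    (vadd (vscal (vy (r u v)) b) (vscal (vz (r u v)) c)).

Definition h_sol (u v : R) : R :=
  3 / (2 * sinh (sqrt 3 / 2 * (u + v)) ^ 2) + 1.

(* Main.v *)
Require Import Defs.
From Stdlib Require Import Reals Lra.
From Coquelicot Require Import Coquelicot.

Open Scope R_scope.

(** Put [s = u + v], [H = h - 1] and [p = H'/H = - sqrt 3 coth (sqrt 3 / 2 * s)].
    Then [p' = (p^2 - 3) / 2 = H] and [h = (p^2 - 1) / 2], so both PDEs become
    identities between rational functions of [p].

    In both linear systems [r_uv = h r], the [r_u]-coefficient of [r_uu] is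
    [h_u / h] and the [r_v]-coefficient of [r_vv] is [h_v / h].  Hence
    [det (r, r_u, r_v) / h] is a constant [c], and [K / d^4 = - 1 / c^2].  The same
    constancy, applied to any three among four solutions, turns Cramer's rule into
    a linear relation with constant coefficients between the four solutions: no
    uniqueness theorem for the system is needed once a basis is known.

    For the first system, separating variables in [s] and [t = u - v] gives the
    basis [a(s) cos (sqrt 3 / 2 * t)], [a(s) sin (sqrt 3 / 2 * t)], [g(s)] with
    [a = exp (- s / 2) (p - 1)] and [g = exp s (p + 2)], a surface of revolution.
    For the second one, the solutions are [A'(u) + p(u + v) A(u)] with
    [A''' = 3 A' + phi A], an equation solved on the whole line by Picard
    iteration; for fixed [u] the point moves on a line, which is the ruling. *)

(** * Linear third order equations *)

(** Liouville's equation (ln H)'' = H in the variable s has the first integral p^2 = 2 H + k, with k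
    arbitrary. For h = H + 1 it gives (ln h)'' = (H^3 + 3 H^2 + k H) / h^2, while h - 1 / h^2 = (H^3
    + 3 H^2 + 3 H) / h^2. Hence k = 3 is the only value for which both equations hold, and this is
    the source of sqrt 3.

    The theorem speaks of arbitrary independent triples of solutions, and linear independence as
    functions says nothing at a given point. A basis with a known nonzero Wronskian closes this gap:
    in its coordinates independence becomes invertibility of a constant matrix, so the Wronskian of
    the triple is c h with c <> 0. Such a basis is therefore wanted for the ruled system too, where
    [phi] is an arbitrary continuous function and no closed form in u can be expected. The
    dependence on v is explicit there, and what remains is a linear third order equation in u, whose
    three initial values match the three dimensions of the solution space. *)

Lemma is_derive_continuity_pt (f : R -> R) (x l : R) :
  is_derive f x l -> continuity_pt f x.
Proof.
  intros H. apply continuity_pt_filterlim.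
  apply (ex_derive_continuous f). now exists l.
Qed.

Lemma derive_nonneg_increasing (f df : R -> R) (a b : R) :
  (forall x, is_derive f x (df x)) -> (forall x, 0 <= df x) ->
  a <= b -> f a <= f b.
Proof.
  intros Hd Hp Hab.
  destruct (MVT_gen f a b df) as [c [_ Hc]].
  - intros x _; apply Hd.
  - intros x _; eapply is_derive_continuity_pt, Hd.
  - assert (0 <= df c * (b - a)) by (apply Rmult_le_pos; [apply Hp | lra]). lra.
Qed.

(** [S - F] and [S + F] have nonnegative derivatives and vanish at 0. To the left of 0 both are
    nonpositive, whence the absolute value around [S t]. *)
Lemma derive_dominated (F S f g : R -> R) (t : R) :
  (forall x, is_derive F x (f x)) -> (forall x, is_derive S x (g x)) ->
  (forall x, Rabs (f x) <= g x) -> F 0 = 0 -> S 0 = 0 ->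
  Rabs (F t) <= Rabs (S t).
Proof.
  intros HF HS Hfg F0 S0.
  assert (P : forall x y, x <= y -> S x - F x <= S y - F y).
  { intros x y Hxy. apply (derive_nonneg_increasing (fun z => S z - F z) (fun z => g z - f z)); auto.
    - intros z. apply (is_derive_minus S F); auto.
    - intros z. specialize (Hfg z). apply Rabs_le_between in Hfg. lra. }
  assert (Q : forall x y, x <= y -> S x + F x <= S y + F y).
  { intros x y Hxy. apply (derive_nonneg_increasing (fun z => S z + F z) (fun z => g z + f z)); auto.
    - intros z. apply (is_derive_plus S F); auto.
    - intros z. specialize (Hfg z). apply Rabs_le_between in Hfg. lra. }
  destruct (Rle_lt_dec 0 t) as [Ht|Ht].
  - specialize (P 0 t Ht). specialize (Q 0 t Ht).
    rewrite (Rabs_pos_eq (S t)) by lra. apply Rabs_le. lra.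
  - assert (Ht' : t <= 0) by lra. specialize (P t 0 Ht'). specialize (Q t 0 Ht').
    rewrite (Rabs_left1 (S t)) by lra. apply Rabs_le. lra.
Qed.

Lemma is_derive_RInt_0 (f : R -> R) (t : R) :
  (forall x, continuous f x) -> is_derive (fun y => RInt f 0 y) t (f t).
Proof.
  intros Hf. apply (is_derive_RInt f (fun y => RInt f 0 y) 0).
  - exists (mkposreal 1 Rlt_0_1). intros y _. apply (RInt_correct f).
    apply (ex_RInt_continuous f). intros z _. apply Hf.
  - apply Hf.
Qed.

(** Hypothesis of the Weierstrass test on every ball. The constant depends on the radius, since
    solutions may grow arbitrarily fast with [phi]; the ratio does not. *)
Definition geometrically_bounded (F : nat -> R -> R) : Prop :=
  forall r, exists K, forall n y, Rabs y < r -> Rabs (F n y) <= K * (/ 2) ^ n.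

Lemma geometrically_bounded_CVU (F : nat -> R -> R) (t : R) :
  geometrically_bounded F ->
  exists e : posreal,
    CVU (fun n => SP F n) (fun x => Series (fun n => F n x)) t e.
Proof.
  intros HF.
  assert (Hr : 0 < Rabs t + 1) by (pose proof (Rabs_pos t); lra).
  destruct (HF (Rabs t + 1)) as [K HK].
  apply (CVN_CVU_r F (mkposreal _ Hr)); [| simpl; lra].
  exists (fun n => K * (/ 2) ^ n).
  assert (HS : ex_series (fun k => Rabs (K * (/ 2) ^ k))).
  { apply ex_series_ext with (fun k => scal (Rabs K) ((/ 2) ^ k)).
    - intros n. rewrite Rabs_mult, (Rabs_pos_eq ((/2) ^ n)); [reflexivity|].
      apply pow_le; lra.
    - apply (ex_series_scal_l (Rabs K) (fun k => (/ 2) ^ k)).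
      apply ex_series_geom. rewrite Rabs_pos_eq; lra. }
  exists (Series (fun k => Rabs (K * (/ 2) ^ k))). split.
  - apply is_series_Reals. now apply Series_correct.
  - intros n y Hy. apply HK. unfold Boule in Hy. simpl in Hy.
    now rewrite Rminus_0_r in Hy.
Qed.

Lemma geometrically_bounded_ex_series (F : nat -> R -> R) (t : R) :
  geometrically_bounded F -> ex_series (fun n => F n t).
Proof.
  intros HF. destruct (HF (Rabs t + 1)) as [K HK].
  apply (ex_series_le (fun n => F n t) (fun n => K * (/ 2) ^ n)).
  - intros n. apply HK. lra.
  - apply (ex_series_scal_l K (fun k => (/ 2) ^ k)).
    apply ex_series_geom. rewrite Rabs_pos_eq; lra.
Qed.

(** Termwise differentiation: uniform convergence near [t] is used for the derivatives, pointwise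
    convergence for the functions themselves. *)
Lemma is_derive_Series (F F' : nat -> R -> R) (t : R) :
  (forall n x, is_derive (F n) x (F' n x)) ->
  geometrically_bounded F -> geometrically_bounded F' ->
  is_derive (fun x => Series (fun n => F n x)) t (Series (fun n => F' n t)).
Proof.
  intros Hd HF HF'.
  destruct (geometrically_bounded_CVU F' t HF') as [e He].
  apply is_derive_Reals.
  apply (CVU_derivable (fun n => SP F n) (fun n => SP F' n) _
           (fun x => Series (fun n => F' n x)) t e He).
  - intros x _. apply is_series_Reals, Series_correct.
    now apply geometrically_bounded_ex_series.
  - intros n x _. unfold SP. induction n as [|n IH]; simpl.
    + apply is_derive_Reals, Hd.
    + apply (derivable_pt_lim_plus (fun x => sum_f_R0 (fun k => F k x) n) (F (S n))); auto.
      apply is_derive_Reals, Hd.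
  - unfold Boule. rewrite Rminus_eq_0, Rabs_R0. apply cond_pos.
Qed.

(** The n-th term of a Neumann series, not the n-th Picard iterate: the system (A, B, C)' = (B, C, 3
    B + phi A) is linear, so the differences of consecutive iterates arise from [v0] by repeated
    integration, and their sum is the solution. *)
Fixpoint picard (phi : R -> R) (v0 : vec3) (n : nat) (t : R) : vec3 :=
  match n with
  | O => v0
  | S n =>
      Vec3 (RInt (fun s => vy (picard phi v0 n s)) 0 t)
           (RInt (fun s => vz (picard phi v0 n s)) 0 t)
           (RInt (fun s => 3 * vy (picard phi v0 n s)
                           + phi s * vx (picard phi v0 n s)) 0 t)
  end.

(** The derivative of term n + 1 is the right-hand side of the system at term n; summed over n, this
    index shift is the differential equation. *)
Definition picard_deriv (phi : R -> R) (v0 : vec3) (n : nat) (t : R) : vec3 :=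
  match n with
  | O => Vec3 0 0 0
  | S n => Vec3 (vy (picard phi v0 n t)) (vz (picard phi v0 n t))
             (3 * vy (picard phi v0 n t) + phi t * vx (picard phi v0 n t))
  end.

Lemma continuous_rhs (phi b a : R -> R) (t : R) :
  continuous phi t -> continuous a t -> continuous b t ->
  continuous (fun s => 3 * b s + phi s * a s) t.
Proof.
  intros Hphi Ha Hb.
  apply (continuous_plus (fun s => 3 * b s) (fun s => phi s * a s)).
  - apply (continuous_mult (fun _ => 3) b); auto. apply continuous_const.
  - apply (continuous_mult phi a); auto.
Qed.

Lemma picard_is_derive (phi : R -> R) (v0 : vec3) (n : nat) :
  (forall u, continuous phi u) -> forall t,
  is_derive (fun t => vx (picard phi v0 n t)) t (vx (picard_deriv phi v0 n t)) /\
  is_derive (fun t => vy (picard phi v0 n t)) t (vy (picard_deriv phi v0 n t)) /\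
  is_derive (fun t => vz (picard phi v0 n t)) t (vz (picard_deriv phi v0 n t)).
Proof.
  intros Hphi. induction n as [|n IH]; intros t; simpl.
  - split; [|split]; apply (is_derive_const (V := R_NormedModule)).
  - assert (Hcont : forall x,
       continuous (fun t => vx (picard phi v0 n t)) x /\
       continuous (fun t => vy (picard phi v0 n t)) x /\
       continuous (fun t => vz (picard phi v0 n t)) x).
    { intros x. destruct (IH x) as (H1 & H2 & H3).
      repeat split; apply @ex_derive_continuous; eexists; eassumption. }
    split; [|split].
    + apply (is_derive_RInt_0 (fun t => vy (picard phi v0 n t))). apply Hcont.
    + apply (is_derive_RInt_0 (fun t => vz (picard phi v0 n t))). apply Hcont.
    + apply (is_derive_RInt_0 (fun t => 3 * vy (picard phi v0 n t) + phi t * vx (picard phi v0 n t))).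
      intros x. destruct (Hcont x) as (cx & cy & _). now apply continuous_rhs.
Qed.

Definition vbound (M : R) (a : vec3) : Prop :=
  Rabs (vx a) <= M /\ Rabs (vy a) <= M /\ Rabs (vz a) <= M.

(** [4 + Rabs (phi s)] dominates the absolute row sums 1, 1 and 3 + |phi| of the system; the factor
    2 in front is what becomes the gain 1/2 per step. *)
Definition weight_exponent (phi : R -> R) (t : R) : R :=
  RInt (fun s => 2 * (4 + Rabs (phi s))) 0 t.

Lemma cosh_pos (x : R) : 0 < cosh x.
Proof. unfold cosh. pose proof (exp_pos x). pose proof (exp_pos (- x)). lra. Qed.

Lemma exp_le_compat (x y : R) : x <= y -> exp x <= exp y.
Proof. intros [H| ->]; [left; now apply exp_increasing | apply Rle_refl]. Qed.

Lemma Rabs_sinh_le_cosh (x : R) : Rabs (sinh x) <= cosh x.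
Proof.
  apply Rabs_le. unfold sinh, cosh.
  pose proof (exp_pos x). pose proof (exp_pos (- x)). lra.
Qed.

Lemma weight_exponent_is_derive (phi : R -> R) (t : R) :
  (forall u, continuous phi u) ->
  is_derive (weight_exponent phi) t (2 * (4 + Rabs (phi t))).
Proof.
  intros Hphi. apply (is_derive_RInt_0 (fun s => 2 * (4 + Rabs (phi s)))).
  intros x. apply (continuous_mult (fun _ => 2) (fun s => 4 + Rabs (phi s))).
  - apply continuous_const.
  - apply (continuous_plus (fun _ => 4) (fun s => Rabs (phi s))).
    + apply continuous_const.
    + apply (continuous_comp phi Rabs); auto. apply continuous_Rabs.
Qed.

(* The weight [cosh (int_0^t 2 (4 + |phi|))] absorbs the growth of the system:
   each Picard step gains a factor 1/2, uniformly on the line. *)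
Lemma picard_bound (phi : R -> R) (v0 : vec3) (K : R) :
  (forall u, continuous phi u) -> vbound K v0 -> forall n t,
  vbound (K * (/ 2) ^ n * cosh (weight_exponent phi t)) (picard phi v0 n t).
Proof.
  intros Hphi H0.
  assert (HK : 0 <= K).
  { destruct H0 as [H _]. pose proof (Rabs_pos (vx v0)). lra. }
  assert (W0 : weight_exponent phi 0 = 0) by apply @RInt_point.
  assert (Hc1 : forall t, 1 <= cosh t).
  { intros t. destruct (Req_dec t 0) as [->|Ht].
    - rewrite cosh_0; lra.
    - unfold cosh. pose proof (exp_ineq1 t Ht).
      assert (Ht' : - t <> 0) by lra. pose proof (exp_ineq1 (- t) Ht'). lra. }
  induction n as [|n IH]; intros t.
  - simpl. set (c := cosh _). assert (1 <= c) by apply Hc1.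
    assert (K <= K * 1 * c) by nra.
    destruct H0 as (A & B & C). repeat split; lra.
  - set (Kn := K * (/ 2) ^ n) in *.
    assert (HKn : 0 <= Kn).
    { apply Rmult_le_pos; auto. apply pow_le; lra. }
    assert (Step : forall F f : R -> R, (forall x, is_derive F x (f x)) -> F 0 = 0 ->
      (forall x, Rabs (f x) <= (4 + Rabs (phi x)) * (Kn * cosh (weight_exponent phi x))) ->
      Rabs (F t) <= K * (/ 2) ^ S n * cosh (weight_exponent phi t)).
    { intros F f HF F0 Hf.
      (* The comparison function Kn / 2 sinh(w), with w the weight exponent, vanishes at 0, and its
         derivative is exactly the bound (4 + |phi|) Kn cosh(w) assumed on [f]. Being odd in w, it
         serves on both sides of 0. *)
      apply Rle_trans with (Rabs (Kn / 2 * sinh (weight_exponent phi t))).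
      - apply (derive_dominated F (fun x => Kn / 2 * sinh (weight_exponent phi x)) f
           (fun x => (4 + Rabs (phi x)) * (Kn * cosh (weight_exponent phi x)))); auto.
        + intros x.
          replace ((4 + Rabs (phi x)) * (Kn * cosh (weight_exponent phi x)))
            with (Kn / 2 * (2 * (4 + Rabs (phi x)) * cosh (weight_exponent phi x))) by field.
          apply is_derive_scal.
          apply (is_derive_comp sinh (weight_exponent phi)).
          * apply is_derive_Reals, derivable_pt_lim_sinh.
          * now apply weight_exponent_is_derive.
        + rewrite W0, sinh_0. ring.
      - rewrite Rabs_mult, (Rabs_pos_eq (Kn / 2)) by lra.
        replace (K * (/ 2) ^ S n) with (Kn / 2) by (unfold Kn; simpl; field).
        apply Rmult_le_compat_l; [lra | apply Rabs_sinh_le_cosh]. }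
    pose proof (picard_is_derive phi v0 (S n) Hphi) as HD.
    repeat split.
    + apply (Step _ _ (fun x => proj1 (HD x))).
      * simpl. apply @RInt_point.
      * intros x. simpl. destruct (IH x) as (A & B & C).
        pose proof (Rabs_pos (phi x)). pose proof (Rabs_pos (vy (picard phi v0 n x))). nra.
    + apply (Step _ _ (fun x => proj1 (proj2 (HD x)))).
      * simpl. apply @RInt_point.
      * intros x. simpl. destruct (IH x) as (A & B & C).
        pose proof (Rabs_pos (phi x)). pose proof (Rabs_pos (vz (picard phi v0 n x))). nra.
    + apply (Step _ _ (fun x => proj2 (proj2 (HD x)))).
      * simpl. apply @RInt_point.
      * intros x. simpl. destruct (IH x) as (A & B & C).
        eapply Rle_trans; [apply Rabs_triang|]. rewrite !Rabs_mult, (Rabs_pos_eq 3) by lra.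
        pose proof (Rabs_pos (phi x)). pose proof (Rabs_pos (vy (picard phi v0 n x))).
        assert (Rabs (phi x) * Rabs (vx (picard phi v0 n x)) <= Rabs (phi x) * (Kn * cosh (weight_exponent phi x)))
          by (apply Rmult_le_compat_l; auto).
        nra.
Qed.

(** The exponent is nondecreasing, so its two exponentials are controlled by opposite ends of the
    interval. *)
Lemma cosh_weight_bounded (phi : R -> R) (r : R) :
  (forall u, continuous phi u) ->
  exists M, forall y, Rabs y < r -> cosh (weight_exponent phi y) <= M.
Proof.
  intros Hphi. exists (exp (weight_exponent phi r) + exp (- weight_exponent phi (- r))).
  intros y Hy. apply Rabs_lt_between in Hy.
  assert (Mono : forall a b, a <= b -> weight_exponent phi a <= weight_exponent phi b).
  { intros a b Hab. apply (derive_nonneg_increasing _ (fun t => 2 * (4 + Rabs (phi t)))); auto.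
    - intros x. now apply weight_exponent_is_derive.
    - intros x. pose proof (Rabs_pos (phi x)). lra. }
  assert (E1 : exp (weight_exponent phi y) <= exp (weight_exponent phi r)).
  { apply exp_le_compat, Mono. lra. }
  assert (E2 : exp (- weight_exponent phi y) <= exp (- weight_exponent phi (- r))).
  { apply exp_le_compat.
    assert (weight_exponent phi (- r) <= weight_exponent phi y) by (apply Mono; lra). lra. }
  unfold cosh.
  pose proof (exp_pos (weight_exponent phi y)). pose proof (exp_pos (- weight_exponent phi y)).
  lra.
Qed.

Lemma picard_geometric (phi : R -> R) (v0 : vec3) :
  (forall u, continuous phi u) ->
  forall r, exists K, 0 <= K /\ forall n y, Rabs y < r ->
    vbound (K * (/ 2) ^ n) (picard phi v0 n y).
Proof.
  intros Hphi r.
  set (K := Rabs (vx v0) + Rabs (vy v0) + Rabs (vz v0)).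
  assert (H0 : vbound K v0).
  { unfold K. pose proof (Rabs_pos (vx v0)). pose proof (Rabs_pos (vy v0)).
    pose proof (Rabs_pos (vz v0)). repeat split; lra. }
  assert (HK : 0 <= K) by (destruct H0 as [H _]; pose proof (Rabs_pos (vx v0)); lra).
  destruct (cosh_weight_bounded phi r Hphi) as [M HM].
  (* [M] carries no sign: for r <= 0 its bound is vacuous. *)
  exists (K * Rmax M 0). split.
  - apply Rmult_le_pos; auto. apply Rmax_r.
  - intros n y Hy. pose proof (picard_bound phi v0 K Hphi H0 n y) as (A & B & C).
    assert (K * (/ 2) ^ n * cosh (weight_exponent phi y) <= K * Rmax M 0 * (/ 2) ^ n).
    { replace (K * Rmax M 0 * (/ 2) ^ n) with (K * (/ 2) ^ n * Rmax M 0) by ring.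
      apply Rmult_le_compat_l.
      - apply Rmult_le_pos; auto. apply pow_le; lra.
      - eapply Rle_trans; [now apply HM | apply Rmax_l]. }
    repeat split; lra.
Qed.

Lemma third_order_ode_solution (phi : R -> R) (a0 b0 c0 : R) :
  (forall u, continuous phi u) ->
  exists A B C : R -> R,
    (forall t, is_derive A t (B t)) /\ (forall t, is_derive B t (C t)) /\
    (forall t, is_derive C t (3 * B t + phi t * A t)) /\
    A 0 = a0 /\ B 0 = b0 /\ C 0 = c0.
Proof.
  intros Hphi. set (v0 := Vec3 a0 b0 c0).
  pose proof (picard_geometric phi v0 Hphi) as HG.
  assert (Gx : geometrically_bounded (fun n t => vx (picard phi v0 n t))).
  { intros r. destruct (HG r) as (K & _ & HK). exists K. intros n y Hy. now apply HK. }
  assert (Gy : geometrically_bounded (fun n t => vy (picard phi v0 n t))).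
  { intros r. destruct (HG r) as (K & _ & HK). exists K. intros n y Hy. now apply HK. }
  assert (Gz : geometrically_bounded (fun n t => vz (picard phi v0 n t))).
  { intros r. destruct (HG r) as (K & _ & HK). exists K. intros n y Hy. now apply HK. }
  (* Derivatives are bounded one index late; doubling the constant absorbs the shift, and the
     derivative of the constant term 0 vanishes. *)
  assert (Shift : forall F : nat -> R -> R,
    (forall r, exists K, 0 <= K /\ forall n y, Rabs y < r -> Rabs (F (S n) y) <= K * (/ 2) ^ n) ->
    (forall y, F O y = 0) -> geometrically_bounded F).
  { intros F HF F0 r. destruct (HF r) as (K & K0 & HK). exists (2 * K). intros [|n] y Hy.
    - rewrite F0, Rabs_R0. simpl. lra.
    - replace (2 * K * (/ 2) ^ S n) with (K * (/ 2) ^ n) by (simpl; field). now apply HK. }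
  assert (Gx' : geometrically_bounded (fun n t => vx (picard_deriv phi v0 n t))).
  { apply Shift; [|reflexivity]. intros r. destruct (HG r) as (K & K0 & HK).
    exists K. split; auto. intros n y Hy. simpl. now apply HK. }
  assert (Gy' : geometrically_bounded (fun n t => vy (picard_deriv phi v0 n t))).
  { apply Shift; [|reflexivity]. intros r. destruct (HG r) as (K & K0 & HK).
    exists K. split; auto. intros n y Hy. simpl. now apply HK. }
  assert (Gz' : geometrically_bounded (fun n t => vz (picard_deriv phi v0 n t))).
  { apply Shift; [|reflexivity]. intros r. destruct (HG r) as (K & K0 & HK).
    (* Only the third component involves [phi], which is bounded on the compact interval. *)
    destruct (bounded_continuity phi (- r) r) as [M HM].
    { intros x _. apply Hphi. }
    exists ((3 + Rabs M) * K). split.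
    { apply Rmult_le_pos; auto. pose proof (Rabs_pos M). lra. }
    intros n y Hy. simpl. destruct (HK n y Hy) as (P & Q & _).
    assert (Hphiy : Rabs (phi y) <= Rabs M).
    { apply Rle_trans with M; [|apply Rle_abs]. left. apply (HM y).
      apply Rabs_lt_between in Hy. lra. }
    eapply Rle_trans; [apply Rabs_triang|]. rewrite !Rabs_mult, (Rabs_pos_eq 3) by lra.
    replace ((3 + Rabs M) * K * (/ 2) ^ n) with (3 * (K * (/ 2) ^ n) + Rabs M * (K * (/ 2) ^ n)) by ring.
    apply Rplus_le_compat; [lra|].
    apply Rmult_le_compat; auto using Rabs_pos. }
  exists (fun t => Series (fun n => vx (picard phi v0 n t))),
         (fun t => Series (fun n => vy (picard phi v0 n t))),
         (fun t => Series (fun n => vz (picard phi v0 n t))).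
  (* At t = 0 every term after the first is an integral from 0 to 0, so the series keeps only the
     component of [v0]. *)
  assert (Init : forall F : nat -> R, (forall n, F (S n) = 0) -> Series F = F O).
  { intros F HF. apply is_series_unique.
    apply filterlim_ext with (fun _ => F O); [|apply filterlim_const].
    intros n. induction n as [|n IH].
    - now rewrite sum_O.
    - rewrite sum_Sn, <- IH, HF. symmetry. apply Rplus_0_r. }
  split; [|split; [|split; [|split; [|split]]]].
  - intros t. pose proof (is_derive_Series _ _ t
      (fun n x => proj1 (picard_is_derive phi v0 n Hphi x)) Gx Gx') as H.
    (* Dropping the zero first term realigns the series of derivatives with the series of the next
       component. *)
    now rewrite Series_incr_1_aux in H.
  - intros t. pose proof (is_derive_Series _ _ t
      (fun n x => proj1 (proj2 (picard_is_derive phi v0 n Hphi x))) Gy Gy') as H.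
    now rewrite Series_incr_1_aux in H.
  - intros t. pose proof (is_derive_Series _ _ t
      (fun n x => proj2 (proj2 (picard_is_derive phi v0 n Hphi x))) Gz Gz') as H.
    rewrite Series_incr_1_aux in H by reflexivity. simpl in H.
    rewrite Series_plus, !Series_scal_l in H; auto.
    + apply (ex_series_scal_l 3 (fun n => vy (picard phi v0 n t))).
      now apply (geometrically_bounded_ex_series (fun n t => vy (picard phi v0 n t))).
    + apply (ex_series_scal_l (phi t) (fun n => vx (picard phi v0 n t))).
      now apply (geometrically_bounded_ex_series (fun n t => vx (picard phi v0 n t))).
  - apply (Init (fun n => vx (picard phi v0 n 0))). intros n. apply @RInt_point.
  - apply (Init (fun n => vy (picard phi v0 n 0))). intros n. apply @RInt_point.
  - apply (Init (fun n => vz (picard phi v0 n 0))). intros n. apply @RInt_point.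
Qed.

(** * Partial derivatives and Wronskians on the components *)

Definition open2 (D : R -> R -> Prop) : Prop :=
  forall u v, D u v -> locally_2d D u v.

Lemma open2_locally_1 (D : R -> R -> Prop) (u v : R) :
  open2 D -> D u v -> locally u (fun t => D t v).
Proof. intros HO Huv. apply locally_2d_1d_const_y. now apply HO. Qed.

Lemma open2_locally_2 (D : R -> R -> Prop) (u v : R) :
  open2 D -> D u v -> locally v (fun t => D u t).
Proof. intros HO Huv. apply locally_2d_1d_const_x. now apply HO. Qed.

Lemma uv_domain_open : open2 uv_domain.
Proof.
  intros u v H. apply (continuity_2d_pt_neq_0 (fun u v => u + v)); auto.
  apply continuity_2d_pt_plus; [apply continuity_2d_pt_id1 | apply continuity_2d_pt_id2].
Qed.

Lemma component_open (D : R -> R -> Prop) : is_component D -> open2 D.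
Proof.
  intros HD u v Huv.
  assert (Hpos : 0 < Rabs (u + v) / 2).
  { assert (u + v <> 0) by (destruct HD as [-> | ->]; unfold uv_domain_pos, uv_domain_neg in Huv; lra).
    pose proof (Rabs_pos_lt (u + v) H). lra. }
  exists (mkposreal _ Hpos). simpl. intros x y Hx Hy.
  apply Rabs_lt_between in Hx. apply Rabs_lt_between in Hy.
  destruct HD as [-> | ->]; unfold uv_domain_pos, uv_domain_neg in *.
  - rewrite (Rabs_pos_eq (u + v)) in * by lra. lra.
  - rewrite (Rabs_left (u + v)) in * by lra. lra.
Qed.

Lemma component_uv_domain (D : R -> R -> Prop) (u v : R) :
  is_component D -> D u v -> uv_domain u v.
Proof.
  intros [-> | ->]; unfold uv_domain_pos, uv_domain_neg, uv_domain; lra.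
Qed.

Lemma C2_on_sub (D D' : R -> R -> Prop) (f : R -> R -> R) :
  (forall u v, D u v -> D' u v) -> C2_on D' f -> C2_on D f.
Proof. intros H Hf u v Huv. auto. Qed.

(** A certificate of class C^2 with explicit partial derivatives. Once it is established, iterated
    [D1] and [D2] are evaluated by rewriting and the differential equations become algebra. *)
Record has_partials (D : R -> R -> Prop) (f fu fv fuu fuv fvu fvv : R -> R -> R) : Prop := {
  hp_u : forall u v, D u v -> is_derive (fun t => f t v) u (fu u v);
  hp_v : forall u v, D u v -> is_derive (fun t => f u t) v (fv u v);
  hp_uu : forall u v, D u v -> is_derive (fun t => fu t v) u (fuu u v);
  hp_uv : forall u v, D u v -> is_derive (fun t => fu u t) v (fuv u v);
  hp_vu : forall u v, D u v -> is_derive (fun t => fv t v) u (fvu u v);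
  hp_vv : forall u v, D u v -> is_derive (fun t => fv u t) v (fvv u v);
  hp_cont : forall u v, D u v ->
    continuity_2d_pt f u v /\ continuity_2d_pt fu u v /\ continuity_2d_pt fv u v /\
    continuity_2d_pt fuu u v /\ continuity_2d_pt fuv u v /\
    continuity_2d_pt fvu u v /\ continuity_2d_pt fvv u v }.

(** Closed forms hold on [D] only. Since the slices of an open set are open, this is enough to
    differentiate them a second time. *)
Lemma is_derive_D1_ext (D : R -> R -> Prop) (g fu : R -> R -> R) (u v l : R) :
  open2 D -> D u v -> (forall u v, D u v -> fu u v = g u v) ->
  is_derive (fun t => fu t v) u l -> is_derive (fun t => g t v) u l.
Proof.
  intros HO Huv He. apply is_derive_ext_loc.
  generalize (open2_locally_1 D u v HO Huv). apply filter_imp. auto.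
Qed.

Lemma is_derive_D2_ext (D : R -> R -> Prop) (g fu : R -> R -> R) (u v l : R) :
  open2 D -> D u v -> (forall u v, D u v -> fu u v = g u v) ->
  is_derive (fun t => fu u t) v l -> is_derive (fun t => g u t) v l.
Proof.
  intros HO Huv He. apply is_derive_ext_loc.
  generalize (open2_locally_2 D u v HO Huv). apply filter_imp. auto.
Qed.

Lemma continuity_2d_pt_ext_on (D : R -> R -> Prop) (f g : R -> R -> R) (u v : R) :
  open2 D -> D u v -> (forall u v, D u v -> f u v = g u v) ->
  continuity_2d_pt f u v -> continuity_2d_pt g u v.
Proof.
  intros HO Huv He. apply continuity_2d_pt_ext_loc.
  destruct (HO u v Huv) as [d Hd]. exists d. auto.
Qed.


Lemma has_partials_D1 D f fu fv fuu fuv fvu fvv u v :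
  has_partials D f fu fv fuu fuv fvu fvv -> D u v -> D1 f u v = fu u v.
Proof. intros Hp Huv. apply is_derive_unique. exact (hp_u _ _ _ _ _ _ _ _ Hp u v Huv). Qed.

Lemma has_partials_D2 D f fu fv fuu fuv fvu fvv u v :
  has_partials D f fu fv fuu fuv fvu fvv -> D u v -> D2 f u v = fv u v.
Proof. intros Hp Huv. apply is_derive_unique. exact (hp_v _ _ _ _ _ _ _ _ Hp u v Huv). Qed.

Lemma has_partials_second D f fu fv fuu fuv fvu fvv u v :
  open2 D -> has_partials D f fu fv fuu fuv fvu fvv -> D u v ->
  is_derive (fun t => D1 f t v) u (fuu u v) /\
  is_derive (fun t => D1 f u t) v (fuv u v) /\
  is_derive (fun t => D2 f t v) u (fvu u v) /\
  is_derive (fun t => D2 f u t) v (fvv u v).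
Proof.
  intros HO Hp Huv.
  assert (E1 : forall u v, D u v -> fu u v = D1 f u v)
    by (intros; symmetry; eapply has_partials_D1; eauto).
  assert (E2 : forall u v, D u v -> fv u v = D2 f u v)
    by (intros; symmetry; eapply has_partials_D2; eauto).
  destruct Hp as [Hu Hv Huu Huv' Hvu Hvv _].
  split; [|split; [|split]].
  - apply (is_derive_D1_ext D _ fu); auto.
  - apply (is_derive_D2_ext D _ fu); auto.
  - apply (is_derive_D1_ext D _ fv); auto.
  - apply (is_derive_D2_ext D _ fv); auto.
Qed.

Lemma has_partials_D11 D f fu fv fuu fuv fvu fvv u v :
  open2 D -> has_partials D f fu fv fuu fuv fvu fvv -> D u v -> D1 (D1 f) u v = fuu u v.
Proof.
  intros HO Hp Huv. apply is_derive_unique.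
  now apply (has_partials_second _ _ _ _ _ _ _ _ u v HO Hp).
Qed.

Lemma has_partials_D12 D f fu fv fuu fuv fvu fvv u v :
  open2 D -> has_partials D f fu fv fuu fuv fvu fvv -> D u v -> D2 (D1 f) u v = fuv u v.
Proof.
  intros HO Hp Huv. apply is_derive_unique.
  now apply (has_partials_second _ _ _ _ _ _ _ _ u v HO Hp).
Qed.

Lemma has_partials_D22 D f fu fv fuu fuv fvu fvv u v :
  open2 D -> has_partials D f fu fv fuu fuv fvu fvv -> D u v -> D2 (D2 f) u v = fvv u v.
Proof.
  intros HO Hp Huv. apply is_derive_unique.
  now apply (has_partials_second _ _ _ _ _ _ _ _ u v HO Hp).
Qed.

Lemma has_partials_C2_on D f fu fv fuu fuv fvu fvv :
  open2 D -> has_partials D f fu fv fuu fuv fvu fvv -> C2_on D f.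
Proof.
  intros HO Hp u v Huv.
  assert (E1 : forall u v, D u v -> fu u v = D1 f u v)
    by (intros; symmetry; eapply has_partials_D1; eauto).
  assert (E2 : forall u v, D u v -> fv u v = D2 f u v)
    by (intros; symmetry; eapply has_partials_D2; eauto).
  assert (HS := fun u v => has_partials_second _ _ _ _ _ _ _ _ u v HO Hp).
  pose proof Hp as [Hu Hv Huu Huv' Hvu Hvv Hc].
  destruct (Hc u v Huv) as (C0 & C1 & C2 & C3 & C4 & C5 & C6).
  destruct (HS u v Huv) as (S1 & S2 & S3 & S4).
  assert (E : forall g fuu, (forall u v, D u v -> fuu u v = g u v) ->
     continuity_2d_pt fuu u v -> continuity_2d_pt g u v).
  { intros g g' Hg. now apply (continuity_2d_pt_ext_on D). }
  simpl. split; [exact C0|]. split; [eexists; apply (Hu u v Huv)|].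
  split; [eexists; apply (Hv u v Huv)|]. split.
  - split; [exact (E (D1 f) fu E1 C1)|].
    split; [eexists; exact S1|]. split; [eexists; exact S2|]. split; split; auto.
    + apply (E (D1 (D1 f)) fuu); auto. intros x y Hxy. symmetry. apply is_derive_unique. now apply HS.
    + apply (E (D2 (D1 f)) fuv); auto. intros x y Hxy. symmetry. apply is_derive_unique. now apply HS.
  - split; [exact (E (D2 f) fv E2 C2)|].
    split; [eexists; exact S3|]. split; [eexists; exact S4|]. split; split; auto.
    + apply (E (D1 (D2 f)) fvu); auto. intros x y Hxy. symmetry. apply is_derive_unique. now apply HS.
    + apply (E (D2 (D2 f)) fvv); auto. intros x y Hxy. symmetry. apply is_derive_unique. now apply HS.
Qed.

Lemma C2_on_has_partials (D : R -> R -> Prop) (f : R -> R -> R) :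
  C2_on D f ->
  has_partials D f (D1 f) (D2 f) (D1 (D1 f)) (D2 (D1 f)) (D1 (D2 f)) (D2 (D2 f)).
Proof.
  intros Hf. split; intros u v Huv;
    destruct (Hf u v Huv)
      as (C0 & X1 & X2 & (C1 & X3 & X4 & (C2 & _) & (C3 & _)) & (C4 & X5 & X6 & (C5 & _) & (C6 & _)));
    try (apply Derive_correct; assumption).
  repeat split; assumption.
Qed.

Lemma C2_on_Schwarz (D : R -> R -> Prop) (f : R -> R -> R) (u v : R) :
  open2 D -> C2_on D f -> D u v -> D1 (D2 f) u v = D2 (D1 f) u v.
Proof.
  intros HO Hf Huv. apply Schwarz.
  - destruct (HO u v Huv) as [d Hd]. exists d. intros x y Hx Hy.
    destruct (Hf x y (Hd x y Hx Hy)) as (C0 & X1 & X2 & (C1 & X3 & X4 & _) & (C4 & X5 & X6 & _)).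
    auto.
  - apply (hp_cont _ _ _ _ _ _ _ _ (C2_on_has_partials D f Hf) u v Huv).
  - apply (hp_cont _ _ _ _ _ _ _ _ (C2_on_has_partials D f Hf) u v Huv).
Qed.

(** * Constancy on a half-plane and the Wronskian *)

Lemma is_derive_0_const (f : R -> R) (a b : R) :
  (forall x, Rmin a b <= x <= Rmax a b -> is_derive f x 0) -> f a = f b.
Proof.
  intros H. destruct (MVT_gen f a b (fun _ => 0)) as [c [_ Hc]].
  - intros x Hx. apply H. lra.
  - intros x Hx. eapply is_derive_continuity_pt, H, Hx.
  - lra.
Qed.

Lemma component_inhabited (D : R -> R -> Prop) :
  is_component D -> exists v0, D 0 v0.
Proof.
  intros [-> | ->]; unfold uv_domain_pos, uv_domain_neg; [exists 1 | exists (-1)]; lra.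
Qed.

Lemma component_const (D : R -> R -> Prop) (F : R -> R -> R) :
  is_component D ->
  (forall u v, D u v -> is_derive (fun t => F t v) u 0) ->
  (forall u v, D u v -> is_derive (fun t => F u t) v 0) ->
  exists c, forall u v, D u v -> F u v = c.
Proof.
  intros HD H1 H2. destruct (component_inhabited D HD) as [v0 Hv0].
  exists (F 0 v0). intros u v Huv.
  (* For [V] far enough, the segments (u,v)-(u,V)-(0,V)-(0,v0) stay in the
     half-plane. *)
  assert (HV : exists V,
    (forall y, Rmin v V <= y <= Rmax v V -> D u y) /\
    (forall x, Rmin u 0 <= x <= Rmax u 0 -> D x V) /\
    (forall y, Rmin V v0 <= y <= Rmax V v0 -> D 0 y)).
  { destruct HD as [-> | ->]; unfold uv_domain_pos, uv_domain_neg in *;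
      [exists (Rabs u + Rabs v + Rabs v0 + 1) | exists (- (Rabs u + Rabs v + Rabs v0 + 1))];
      pose proof (Rle_abs u); pose proof (Rabs_maj2 u);
      pose proof (Rle_abs v); pose proof (Rabs_maj2 v);
      pose proof (Rle_abs v0); pose proof (Rabs_maj2 v0);
      repeat split; intros x;
      unfold Rmin, Rmax; destruct Rle_dec; intros; lra. }
  destruct HV as (V & P & Q & T).
  rewrite (is_derive_0_const (fun t => F u t) v V) by auto.
  rewrite (is_derive_0_const (fun t => F t V) u 0) by auto.
  apply (is_derive_0_const (fun t => F 0 t)); auto.
Qed.

Definition wronskian (x y z : R -> R -> R) (u v : R) : R :=
  det3 (Vec3 (x u v) (y u v) (z u v))
       (Vec3 (D1 x u v) (D1 y u v) (D1 z u v))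
       (Vec3 (D2 x u v) (D2 y u v) (D2 z u v)).

(** Both linear systems have this shape, with [beta, gamma] equal to
    [1/h, 1/h] and to [phi(u)/H, 0]. *)
Definition frame_system (D : R -> R -> Prop) (h beta gamma x : R -> R -> R) : Prop :=
  C2_on D x /\
  forall u v, D u v ->
    D1 (D1 x) u v = D1 h u v / h u v * D1 x u v + beta u v * D2 x u v /\
    D2 (D1 x) u v = h u v * x u v /\
    D2 (D2 x) u v = gamma u v * D1 x u v + D2 h u v / h u v * D2 x u v.

Lemma ruled_titeica_system_frame D phi H x :
  ruled_titeica_system D phi H x ->
  frame_system D H (fun u v => phi u / H u v) (fun _ _ => 0) x.
Proof.
  intros [HC Hs]. split; auto. intros u v Huv.
  destruct (Hs u v Huv) as (A & B & E). repeat split; auto. rewrite E. ring.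
Qed.

Lemma is_derive_det3 (a b c d e f g h i : R -> R) (a' b' c' d' e' f' g' h' i' t : R) :
  is_derive a t a' -> is_derive b t b' -> is_derive c t c' ->
  is_derive d t d' -> is_derive e t e' -> is_derive f t f' ->
  is_derive g t g' -> is_derive h t h' -> is_derive i t i' ->
  is_derive (fun s => det3 (Vec3 (a s) (b s) (c s)) (Vec3 (d s) (e s) (f s)) (Vec3 (g s) (h s) (i s))) t
    (det3 (Vec3 a' b' c') (Vec3 (d t) (e t) (f t)) (Vec3 (g t) (h t) (i t)) +
     det3 (Vec3 (a t) (b t) (c t)) (Vec3 d' e' f') (Vec3 (g t) (h t) (i t)) +
     det3 (Vec3 (a t) (b t) (c t)) (Vec3 (d t) (e t) (f t)) (Vec3 g' h' i')).
Proof.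
  intros Ha Hb Hc Hd He Hf Hg Hh Hi.
  unfold det3, dot, cross; simpl. auto_derive.
  - repeat split; eexists; eassumption.
  - repeat match goal with H : is_derive ?k _ _ |- _ =>
      change (Derive (fun s : R => k s) t) with (Derive k t);
      rewrite (is_derive_unique k _ _ H); clear H end.
    ring.
Qed.

(** [W] and [h] have the same logarithmic derivative. *)
Lemma is_derive_div_0 (W h : R -> R) (t h' : R) :
  is_derive h t h' -> h t <> 0 -> is_derive W t (h' / h t * W t) ->
  is_derive (fun s => W s / h s) t 0.
Proof.
  intros Hh Hn HW.
  replace 0 with ((h' / h t * W t * h t - W t * h') / (h t) ^ 2) by (field; auto).
  apply is_derive_div; auto.
Qed.

(* [det(r, r_u, r_v)] satisfies [W_u = (h_u/h) W] and [W_v = (h_v/h) W]. *)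
Lemma wronskian_const (D : R -> R -> Prop) (h beta gamma x y z : R -> R -> R) :
  is_component D -> C2_on D h -> (forall u v, D u v -> h u v <> 0) ->
  frame_system D h beta gamma x -> frame_system D h beta gamma y ->
  frame_system D h beta gamma z ->
  exists c, forall u v, D u v -> wronskian x y z u v = c * h u v.
Proof.
  intros HD Ch Hn [Cx Sx] [Cy Sy] [Cz Sz].
  assert (HO := component_open D HD).
  assert (Ph := C2_on_has_partials D h Ch).
  assert (Px := C2_on_has_partials D x Cx).
  assert (Py := C2_on_has_partials D y Cy).
  assert (Pz := C2_on_has_partials D z Cz).
  destruct (component_const D (fun u v => wronskian x y z u v / h u v) HD) as [c Hc].
  - intros u v Huv.
    apply (is_derive_div_0 (fun t => wronskian x y z t v) (fun t => h t v) u (D1 h u v)); auto.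
    { now apply (hp_u _ _ _ _ _ _ _ _ Ph). }
    evar_last.
    + apply is_derive_det3.
      1-3: eapply hp_u; [|exact Huv]; eassumption.
      1-3: eapply hp_uu; [|exact Huv]; eassumption.
      1-3: eapply hp_vu; [|exact Huv]; eassumption.
    + rewrite !(C2_on_Schwarz D) by auto.
      destruct (Sx u v Huv) as (-> & -> & _), (Sy u v Huv) as (-> & -> & _), (Sz u v Huv) as (-> & -> & _).
      unfold wronskian, det3, dot, cross; simpl. ring.
  - intros u v Huv.
    apply (is_derive_div_0 (fun t => wronskian x y z u t) (fun t => h u t) v (D2 h u v)); auto.
    { now apply (hp_v _ _ _ _ _ _ _ _ Ph). }
    evar_last.
    + apply is_derive_det3.
      1-3: eapply hp_v; [|exact Huv]; eassumption.
      1-3: eapply hp_uv; [|exact Huv]; eassumption.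
      1-3: eapply hp_vv; [|exact Huv]; eassumption.
    + destruct (Sx u v Huv) as (_ & -> & ->), (Sy u v Huv) as (_ & -> & ->), (Sz u v Huv) as (_ & -> & ->).
      unfold wronskian, det3, dot, cross; simpl. ring.
  - exists c. intros u v Huv. rewrite <- (Hc u v Huv). field. auto.
Qed.

(** * Linear dependence of solutions and the Titeica property *)

Lemma det3_eq_0_dependent (m1 m2 m3 : vec3) :
  det3 m1 m2 m3 = 0 ->
  exists a b c : R, ~ (a = 0 /\ b = 0 /\ c = 0) /\
    vadd (vscal a m1) (vadd (vscal b m2) (vscal c m3)) = Vec3 0 0 0.
Proof.
  destruct m1 as [x1 y1 z1], m2 as [x2 y2 z2], m3 as [x3 y3 z3].
  unfold det3, dot, cross, vadd, vscal; simpl. intros H0.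
  assert (K : forall a b c : R,
    a * x1 + (b * x2 + c * x3) = 0 -> a * y1 + (b * y2 + c * y3) = 0 ->
    a * z1 + (b * z2 + c * z3) = 0 -> a <> 0 \/ b <> 0 \/ c <> 0 ->
    exists a b c : R, ~ (a = 0 /\ b = 0 /\ c = 0) /\
    Vec3 (a * x1 + (b * x2 + c * x3)) (a * y1 + (b * y2 + c * y3)) (a * z1 + (b * z2 + c * z3)) = Vec3 0 0 0).
  { intros a b c E1 E2 E3 Hn. exists a, b, c. split; [tauto | congruence]. }
  (* Either some cofactor is nonzero, and its column of cofactors is a relation,
     or the rank is at most 1. *)
  destruct (Req_dec (y2 * z3 - z2 * y3) 0) as [A1|A1];
    [| apply (K (y2 * z3 - z2 * y3) (y3 * z1 - z3 * y1) (y1 * z2 - z1 * y2)); [lra | ring | ring | tauto]].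
  destruct (Req_dec (y3 * z1 - z3 * y1) 0) as [A2|A2];
    [| apply (K (y2 * z3 - z2 * y3) (y3 * z1 - z3 * y1) (y1 * z2 - z1 * y2)); [lra | ring | ring | tauto]].
  destruct (Req_dec (y1 * z2 - z1 * y2) 0) as [A3|A3];
    [| apply (K (y2 * z3 - z2 * y3) (y3 * z1 - z3 * y1) (y1 * z2 - z1 * y2)); [lra | ring | ring | tauto]].
  destruct (Req_dec (z2 * x3 - x2 * z3) 0) as [B1|B1];
    [| apply (K (z2 * x3 - x2 * z3) (z3 * x1 - x3 * z1) (z1 * x2 - x1 * z2)); [ring | lra | ring | tauto]].
  destruct (Req_dec (z3 * x1 - x3 * z1) 0) as [B2|B2];
    [| apply (K (z2 * x3 - x2 * z3) (z3 * x1 - x3 * z1) (z1 * x2 - x1 * z2)); [ring | lra | ring | tauto]].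
  destruct (Req_dec (z1 * x2 - x1 * z2) 0) as [B3|B3];
    [| apply (K (z2 * x3 - x2 * z3) (z3 * x1 - x3 * z1) (z1 * x2 - x1 * z2)); [ring | lra | ring | tauto]].
  destruct (Req_dec (x1 * y2 - y1 * x2) 0) as [C3|C3];
    [| apply (K (x2 * y3 - y2 * x3) (x3 * y1 - y3 * x1) (x1 * y2 - y1 * x2)); [ring | ring | lra | tauto]].
  (* Here [m1] and [m2] are parallel, so any nonzero coordinate of [m1] yields a relation between
     these two; otherwise [m1] is zero and is a relation by itself. *)
  destruct (Req_dec x1 0) as [X|X]; [| apply (K x2 (- x1) 0); lra].
  destruct (Req_dec y1 0) as [Y|Y]; [| apply (K y2 (- y1) 0); lra].
  destruct (Req_dec z1 0) as [Z|Z]; [| apply (K z2 (- z1) 0); lra].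
  apply (K 1 0 0); lra.
Qed.

Lemma solution_combination (D : R -> R -> Prop) (h beta gamma X Y Z x : R -> R -> R) (c0 : R) :
  is_component D -> C2_on D h -> (forall u v, D u v -> h u v <> 0) ->
  frame_system D h beta gamma X -> frame_system D h beta gamma Y ->
  frame_system D h beta gamma Z -> c0 <> 0 ->
  (forall u v, D u v -> wronskian X Y Z u v = c0 * h u v) ->
  frame_system D h beta gamma x ->
  exists a b c : R, forall u v, D u v ->
    x u v = a * X u v + b * Y u v + c * Z u v /\
    D1 x u v = a * D1 X u v + b * D1 Y u v + c * D1 Z u v /\
    D2 x u v = a * D2 X u v + b * D2 Y u v + c * D2 Z u v.
Proof.
  intros HD Ch Hn SX SY SZ Hc0 H0 Sx.
  destruct (wronskian_const D h beta gamma x Y Z) as [c1 H1]; auto.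
  destruct (wronskian_const D h beta gamma X x Z) as [c2 H2]; auto.
  destruct (wronskian_const D h beta gamma X Y x) as [c3 H3]; auto.
  exists (c1 / c0), (c2 / c0), (c3 / c0). intros u v Huv.
  specialize (H0 u v Huv). specialize (H1 u v Huv). specialize (H2 u v Huv). specialize (H3 u v Huv).
  specialize (Hn u v Huv).
  (* Cramer's rule for one row (w, p, q, r) of a linear system. Its coefficients are the same for
     the rows of values, u-derivatives and v-derivatives, so one set of constants serves all
     three. *)
  assert (K : forall w p q r : R,
     w * wronskian X Y Z u v = p * wronskian x Y Z u v + q * wronskian X x Z u v + r * wronskian X Y x u v ->
     w = c1 / c0 * p + c2 / c0 * q + c3 / c0 * r).
  { intros w p q r E. rewrite H0, H1, H2, H3 in E.
    apply (Rmult_eq_reg_r (c0 * h u v)); [| now apply Rmult_integral_contrapositive].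
    rewrite E. field. auto. }
  repeat split; apply K; unfold wronskian, det3, dot, cross; simpl; ring.
Qed.

(** The Wronskian of x, y, z is that of the basis times the determinant of their coordinates. Were
    this determinant zero, a relation between its rows would be a constant relation between x, y, z,
    against independence. *)
Lemma independent_wronskian (D : R -> R -> Prop) (h beta gamma X Y Z x y z : R -> R -> R) (c0 : R) :
  is_component D -> C2_on D h -> (forall u v, D u v -> h u v <> 0) ->
  frame_system D h beta gamma X -> frame_system D h beta gamma Y ->
  frame_system D h beta gamma Z -> c0 <> 0 ->
  (forall u v, D u v -> wronskian X Y Z u v = c0 * h u v) ->
  frame_system D h beta gamma x -> frame_system D h beta gamma y ->
  frame_system D h beta gamma z -> lin_indep D x y z ->
  exists c, c <> 0 /\ forall u v, D u v -> wronskian x y z u v = c * h u v.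
Proof.
  intros HD Ch Hn SX SY SZ Hc0 H0 Sx Sy Sz HI.
  destruct (solution_combination D h beta gamma X Y Z x c0) as (a1 & b1 & c1 & E1); auto.
  destruct (solution_combination D h beta gamma X Y Z y c0) as (a2 & b2 & c2 & E2); auto.
  destruct (solution_combination D h beta gamma X Y Z z c0) as (a3 & b3 & c3 & E3); auto.
  exists (det3 (Vec3 a1 b1 c1) (Vec3 a2 b2 c2) (Vec3 a3 b3 c3) * c0). split.
  - intros Hd. apply Rmult_integral in Hd. destruct Hd as [Hd|Hd]; [|contradiction].
    destruct (det3_eq_0_dependent _ _ _ Hd) as (a & b & c & Hne & He).
    apply Hne, HI. intros u v Huv.
    destruct (E1 u v Huv) as (-> & _), (E2 u v Huv) as (-> & _), (E3 u v Huv) as (-> & _).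
    unfold vadd, vscal in He; simpl in He. injection He as I1 I2 I3.
    replace (_ + _) with ((a * a1 + (b * a2 + c * a3)) * X u v + (a * b1 + (b * b2 + c * b3)) * Y u v
       + (a * c1 + (b * c2 + c * c3)) * Z u v) by ring.
    rewrite I1, I2, I3. ring.
  - intros u v Huv. rewrite Rmult_assoc, <- (H0 u v Huv).
    destruct (E1 u v Huv) as (F1 & F2 & F3), (E2 u v Huv) as (F4 & F5 & F6), (E3 u v Huv) as (F7 & F8 & F9).
    unfold wronskian. rewrite F1, F2, F3, F4, F5, F6, F7, F8, F9.
    unfold det3, dot, cross; simpl. ring.
Qed.

(** A relation valid near one point can be differentiated there in u and in v, which gives a
    homogeneous 3 by 3 system for a, b, c whose determinant is the Wronskian. *)
Lemma wronskian_neq_0_lin_indep (D : R -> R -> Prop) (x y z : R -> R -> R) (u v : R) :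
  open2 D -> D u v -> C2_on D x -> C2_on D y -> C2_on D z ->
  wronskian x y z u v <> 0 -> lin_indep D x y z.
Proof.
  intros HO Huv Cx Cy Cz HW a b c HE.
  assert (Px := C2_on_has_partials D x Cx).
  assert (Py := C2_on_has_partials D y Cy).
  assert (Pz := C2_on_has_partials D z Cz).
  assert (E0 := HE u v Huv).
  assert (E1 : a * D1 x u v + b * D1 y u v + c * D1 z u v = 0).
  { transitivity (Derive (fun t => a * x t v + b * y t v + c * z t v) u).
    - symmetry. apply is_derive_unique.
      apply (is_derive_plus (fun t => a * x t v + b * y t v) (fun t => c * z t v)).
      + apply (is_derive_plus (fun t => a * x t v) (fun t => b * y t v));
          apply is_derive_scal; eapply hp_u; eauto.
      + apply is_derive_scal; eapply hp_u; eauto.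
    - rewrite (Derive_ext_loc _ (fun _ => 0)); [apply Derive_const|].
      generalize (open2_locally_1 D u v HO Huv). apply filter_imp. auto. }
  assert (E2 : a * D2 x u v + b * D2 y u v + c * D2 z u v = 0).
  { transitivity (Derive (fun t => a * x u t + b * y u t + c * z u t) v).
    - symmetry. apply is_derive_unique.
      apply (is_derive_plus (fun t => a * x u t + b * y u t) (fun t => c * z u t)).
      + apply (is_derive_plus (fun t => a * x u t) (fun t => b * y u t));
          apply is_derive_scal; eapply hp_v; eauto.
      + apply is_derive_scal; eapply hp_v; eauto.
    - rewrite (Derive_ext_loc _ (fun _ => 0)); [apply Derive_const|].
      generalize (open2_locally_2 D u v HO Huv). apply filter_imp. auto. }
  (* The multipliers [m1], [m2], [m3] will be the cofactors that isolate one unknown. *)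
  assert (K : forall k m1 m2 m3 : R,
    k * wronskian x y z u v =
      m1 * (a * x u v + b * y u v + c * z u v) +
      m2 * (a * D1 x u v + b * D1 y u v + c * D1 z u v) +
      m3 * (a * D2 x u v + b * D2 y u v + c * D2 z u v) -> k = 0).
  { intros k m1 m2 m3 E. rewrite E0, E1, E2, !Rmult_0_r, !Rplus_0_r in E.
    apply Rmult_integral in E. tauto. }
  unfold wronskian, det3, dot, cross in K; simpl in K.
  repeat split.
  - apply (K a (D1 y u v * D2 z u v - D1 z u v * D2 y u v)
               (D2 y u v * z u v - D2 z u v * y u v)
               (y u v * D1 z u v - z u v * D1 y u v)). ring.
  - apply (K b (D1 z u v * D2 x u v - D1 x u v * D2 z u v)
               (D2 z u v * x u v - D2 x u v * z u v)
               (z u v * D1 x u v - x u v * D1 z u v)). ring.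
  - apply (K c (D1 x u v * D2 y u v - D1 y u v * D2 x u v)
               (D2 x u v * y u v - D2 y u v * x u v)
               (x u v * D1 y u v - y u v * D1 x u v)). ring.
Qed.

(** * Distance to the tangent plane and Gaussian curvature *)

Lemma dot_self_nonneg (a : vec3) : 0 <= dot a a.
Proof. unfold dot. nra. Qed.

Lemma vnorm_sqr (a : vec3) : vnorm a ^ 2 = dot a a.
Proof. unfold vnorm. apply pow2_sqrt, dot_self_nonneg. Qed.

Lemma vec3_ext (p q : vec3) : vx p = vx q -> vy p = vy q -> vz p = vz q -> p = q.
Proof. destruct p, q; simpl; congruence. Qed.

Lemma cross_self_pos (r a b : vec3) :
  det3 r a b <> 0 -> 0 < dot (cross a b) (cross a b).
Proof.
  intros H. destruct (Rle_lt_or_eq_dec _ _ (dot_self_nonneg (cross a b))) as [L|E]; auto.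
  exfalso. apply H. unfold det3. destruct (cross a b) as [p q s].
  unfold dot in *; simpl in *.
  assert (p = 0) by nra. assert (q = 0) by nra. assert (s = 0) by nra. subst. ring.
Qed.

(** Every point p of the plane has p . N = W with N = a x b and W = det(r, a, b), so Cauchy-Schwarz
    bounds |p| below by |W| / |N|. The bound is attained at the foot of the perpendicular, (W /
    |N|^2) N. *)
Lemma plane_distance (r a b : vec3) :
  det3 r a b <> 0 ->
  dist_origin (fun p => exists s t : R, p = vadd r (vadd (vscal s a) (vscal t b)))
  = Rabs (det3 r a b) / vnorm (cross a b).
Proof.
  intros H. set (N := cross a b).
  assert (HN : 0 < dot N N) by now apply (cross_self_pos r).
  assert (Hv : 0 < vnorm N) by now apply sqrt_lt_R0.
  set (W := det3 r a b) in *.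
  unfold dist_origin.
  rewrite (is_glb_Rbar_unique _ (Finite (Rabs W / vnorm N))); [reflexivity|].
  split.
  - intros x (p & (s & t & ->) & ->). simpl.
    set (p := vadd r _).
    assert (E : dot p N = W).
    { unfold p, N, W, det3, dot, cross, vadd, vscal; simpl. ring. }
    apply (Rmult_le_reg_r (vnorm N)); auto.
    replace (Rabs W / vnorm N * vnorm N) with (Rabs W) by (field; lra).
    unfold vnorm. rewrite <- sqrt_mult by apply dot_self_nonneg.
    rewrite <- sqrt_Rsqr_abs. apply sqrt_le_1_alt. rewrite <- E.
    (* Cauchy-Schwarz, by Lagrange's identity *)
    assert (L : dot p p * dot N N = Rsqr (dot p N) + dot (cross p N) (cross p N)).
    { unfold Rsqr, dot, cross; simpl. ring. }
    pose proof (dot_self_nonneg (cross p N)). lra.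
  - intros l Hl. apply Hl.
    set (d := vadd (vscal (W / dot N N) N) (vscal (-1) r)).
    exists (vscal (W / dot N N) N). split.
    + exists (dot (cross d b) N / dot N N), (dot (cross a d) N / dot N N).
      assert (Ed : dot d N = 0).
      { replace (dot d N) with (W / dot N N * dot N N - dot r N)
          by (unfold d, dot, vadd, vscal; simpl; ring).
        unfold W, det3. fold N. field. lra. }
      (* Expansion of [d], the foot minus r, in the basis a, b, N by Cramer's rule, with det(a, b,
         N) = |N|^2. As d . N = 0, the first two coefficients place the foot in the plane. *)
      assert (Edec : vscal (dot N N) d =
         vadd (vscal (dot (cross d b) N) a) (vadd (vscal (dot (cross a d) N) b) (vscal (dot d N) N))).
      { apply vec3_ext; unfold N, dot, cross, vadd, vscal; simpl; ring. }
      rewrite Ed in Edec.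
      assert (Ex := f_equal vx Edec). assert (Ey := f_equal vy Edec). assert (Ez := f_equal vz Edec).
      unfold vadd, vscal in Ex, Ey, Ez; simpl in Ex, Ey, Ez.
      assert (K : forall k A B C S T dk : R, dot N N * dk = S * A + (T * B + 0 * C) ->
         dk = k -> k = S / dot N N * A + T / dot N N * B).
      { intros k A B C0 S T dk E1 E2. apply (Rmult_eq_reg_l (dot N N)); [|lra].
        rewrite <- E2. rewrite E1. field. lra. }
      set (S := dot (cross d b) N / dot N N) in *. set (T := dot (cross a d) N / dot N N) in *.
      apply vec3_ext;
        [ change (W / dot N N * vx N = vx r + (S * vx a + T * vx b));
          enough (W / dot N N * vx N - vx r = S * vx a + T * vx b) by lra
        | change (W / dot N N * vy N = vy r + (S * vy a + T * vy b));
          enough (W / dot N N * vy N - vy r = S * vy a + T * vy b) by lra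
        | change (W / dot N N * vz N = vz r + (S * vz a + T * vz b));
          enough (W / dot N N * vz N - vz r = S * vz a + T * vz b) by lra
        ].
      * apply (K _ _ _ (vx N) _ _ (vx d)); [exact Ex | unfold d, vadd, vscal; simpl; ring].
      * apply (K _ _ _ (vy N) _ _ (vy d)); [exact Ey | unfold d, vadd, vscal; simpl; ring].
      * apply (K _ _ _ (vz N) _ _ (vz d)); [exact Ez | unfold d, vadd, vscal; simpl; ring].
    + unfold vnorm at 2.
      replace (dot (vscal (W / dot N N) N) (vscal (W / dot N N) N)) with (Rsqr (W / vnorm N)).
      * rewrite sqrt_Rsqr_abs. unfold Rdiv. rewrite Rabs_mult, Rabs_inv, (Rabs_pos_eq (vnorm N)) by lra.
        reflexivity.
      * replace (dot (vscal (W / dot N N) N) (vscal (W / dot N N) N))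
          with ((W / dot N N) ^ 2 * dot N N) by (unfold dot, vscal; simpl; ring).
        unfold Rsqr. rewrite <- vnorm_sqr. field. lra.
Qed.

(** The parameter curves are asymptotic: r_uu and r_vv are tangent, so L = N = 0, and r_uv = h r
    gives M = h W / |r_u x r_v|, with W the determinant. Hence K = - h^2 W^2 / |r_u x r_v|^4, while
    d = |W| / |r_u x r_v|. *)
Lemma system_curvature_ratio (D : R -> R -> Prop) (h beta gamma : R -> R -> R)
    (r : R -> R -> vec3) (u v : R) :
  D u v ->
  frame_system D h beta gamma (coord_x r) -> frame_system D h beta gamma (coord_y r) ->
  frame_system D h beta gamma (coord_z r) ->
  det3 (r u v) (vD1 r u v) (vD2 r u v) <> 0 ->
  gauss_curvature r u v / dist_origin (tangent_plane r u v) ^ 4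
  = - (h u v) ^ 2 / det3 (r u v) (vD1 r u v) (vD2 r u v) ^ 2.
Proof.
  intros Huv [_ Sx] [_ Sy] [_ Sz] HW.
  unfold tangent_plane. rewrite plane_distance by exact HW.
  unfold gauss_curvature, unit_normal.
  set (a := vD1 r u v) in *. set (b := vD2 r u v) in *. set (N := cross a b).
  set (W := det3 (r u v) a b) in *.
  assert (HN : 0 < dot N N) by now apply (cross_self_pos (r u v)).
  assert (Hv : 0 < vnorm N) by now apply sqrt_lt_R0.
  assert (Hs : forall p, dot p (vscal (/ vnorm N) N) = dot p N / vnorm N).
  { intros p. unfold dot, vscal, Rdiv; simpl. ring. }
  rewrite !Hs.
  destruct (Sx u v Huv) as (X1 & X2 & X3), (Sy u v Huv) as (Y1 & Y2 & Y3), (Sz u v Huv) as (Z1 & Z2 & Z3).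
  assert (L : dot (vD1 (vD1 r) u v) N = 0).
  { change (vD1 (vD1 r) u v) 
      with (Vec3 (D1 (D1 (coord_x r)) u v) (D1 (D1 (coord_y r)) u v) (D1 (D1 (coord_z r)) u v)).
    rewrite X1, Y1, Z1. unfold N, a, b, vD1, vD2, dot, cross; simpl. ring. }
  assert (NN : dot (vD2 (vD2 r) u v) N = 0).
  { change (vD2 (vD2 r) u v) 
      with (Vec3 (D2 (D2 (coord_x r)) u v) (D2 (D2 (coord_y r)) u v) (D2 (D2 (coord_z r)) u v)).
    rewrite X3, Y3, Z3. unfold N, a, b, vD1, vD2, dot, cross; simpl. ring. }
  assert (M : dot (vD2 (vD1 r) u v) N = h u v * W).
  { change (vD2 (vD1 r) u v) 
      with (Vec3 (D2 (D1 (coord_x r)) u v) (D2 (D1 (coord_y r)) u v) (D2 (D1 (coord_z r)) u v)).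
    rewrite X2, Y2, Z2. unfold W, det3. fold N.
    unfold coord_x, coord_y, coord_z, dot; simpl. ring. }
  rewrite L, NN, M.
  (* Lagrange's identity: E G - F^2 = |r_u x r_v|^2. *)
  replace (dot a a * dot b b - dot a b ^ 2) with (dot N N)
    by (unfold N, dot, cross; simpl; ring).
  replace ((Rabs W / vnorm N) ^ 4) with ((W ^ 2) ^ 2 / (vnorm N ^ 2) ^ 2).
  - rewrite <- vnorm_sqr. field. split; [exact HW | lra].
  - rewrite <- (pow2_abs W). field. lra.
Qed.

Lemma frame_system_titeica_surface (D : R -> R -> Prop) (h beta gamma : R -> R -> R)
    (r : R -> R -> vec3) (c : R) :
  (forall u v, D u v -> h u v <> 0) ->
  frame_system D h beta gamma (coord_x r) -> frame_system D h beta gamma (coord_y r) ->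
  frame_system D h beta gamma (coord_z r) -> c <> 0 ->
  (forall u v, D u v -> wronskian (coord_x r) (coord_y r) (coord_z r) u v = c * h u v) ->
  titeica_surface D r.
Proof.
  intros Hn Sx Sy Sz Hc HW.
  assert (HW' : forall u v, D u v -> det3 (r u v) (vD1 r u v) (vD2 r u v) = c * h u v) by exact HW.
  assert (HW0 : forall u v, D u v -> det3 (r u v) (vD1 r u v) (vD2 r u v) <> 0).
  { intros u v Huv. rewrite HW' by auto. apply Rmult_integral_contrapositive; auto. }
  split; [apply Sx|]. split; [apply Sy|]. split; [apply Sz|]. split; [exact HW0|].
  exists (- / c ^ 2). intros u v Huv.
  rewrite (system_curvature_ratio D h beta gamma) by auto.
  rewrite HW' by auto. field. auto.
Qed.

(** Each coordinate of r' is a combination of those of r, which gives the rows of a matrix; the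
    witnesses are its columns. Its determinant is nonzero because, at any one point, it multiplies
    the Wronskian of r into the nonzero Wronskian of r'. *)
Lemma frame_system_centroaffine (D : R -> R -> Prop) (h beta gamma : R -> R -> R)
    (r r' : R -> R -> vec3) (c c' : R) :
  is_component D -> C2_on D h -> (forall u v, D u v -> h u v <> 0) ->
  frame_system D h beta gamma (coord_x r) -> frame_system D h beta gamma (coord_y r) ->
  frame_system D h beta gamma (coord_z r) ->
  frame_system D h beta gamma (coord_x r') -> frame_system D h beta gamma (coord_y r') ->
  frame_system D h beta gamma (coord_z r') ->
  c <> 0 -> c' <> 0 ->
  (forall u v, D u v -> wronskian (coord_x r) (coord_y r) (coord_z r) u v = c * h u v) ->
  (forall u v, D u v -> wronskian (coord_x r') (coord_y r') (coord_z r') u v = c' * h u v) ->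
  centroaffine_equivalent D r r'.
Proof.
  intros HD Ch Hn Sx Sy Sz Sx' Sy' Sz' Hc Hc' HW HW'.
  destruct (solution_combination D h beta gamma _ _ _ (coord_x r') c HD Ch Hn Sx Sy Sz)
    as (a1 & b1 & c1 & E1); auto.
  destruct (solution_combination D h beta gamma _ _ _ (coord_y r') c HD Ch Hn Sx Sy Sz)
    as (a2 & b2 & c2 & E2); auto.
  destruct (solution_combination D h beta gamma _ _ _ (coord_z r') c HD Ch Hn Sx Sy Sz)
    as (a3 & b3 & c3 & E3); auto.
  exists (Vec3 a1 a2 a3), (Vec3 b1 b2 b3), (Vec3 c1 c2 c3). split.
  - intros Hd. destruct (component_inhabited D HD) as [v Huv]. set (u := 0) in *.
    destruct (E1 u v Huv) as (F1 & F2 & F3), (E2 u v Huv) as (F4 & F5 & F6), (E3 u v Huv) as (F7 & F8 & F9).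
    assert (E : wronskian (coord_x r') (coord_y r') (coord_z r') u v =
      det3 (Vec3 a1 a2 a3) (Vec3 b1 b2 b3) (Vec3 c1 c2 c3) *
      wronskian (coord_x r) (coord_y r) (coord_z r) u v).
    { unfold wronskian. rewrite F1, F2, F3, F4, F5, F6, F7, F8, F9.
      unfold det3, dot, cross; simpl. ring. }
    rewrite Hd, HW', Rmult_0_l in E by auto.
    apply Rmult_integral in E. destruct E; [contradiction | now apply (Hn u v)].
  - intros u v Huv.
    destruct (E1 u v Huv) as (F1 & _), (E2 u v Huv) as (F2 & _), (E3 u v Huv) as (F3 & _).
    unfold coord_x, coord_y, coord_z in *.
    apply vec3_ext; unfold vadd, vscal; simpl; [rewrite F1 | rewrite F2 | rewrite F3]; ring.
Qed.

(** * The two partial differential equations *)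

Definition p_fun (s : R) : R :=
  - sqrt 3 * (cosh (sqrt 3 / 2 * s) / sinh (sqrt 3 / 2 * s)).

Lemma sqrt3_pos : 0 < sqrt 3.
Proof. apply sqrt_lt_R0; lra. Qed.

Lemma sqrt3_sqr : sqrt 3 * sqrt 3 = 3.
Proof. apply sqrt_sqrt; lra. Qed.

Lemma sinh_pos (x : R) : 0 < x -> 0 < sinh x.
Proof. intros H. rewrite <- sinh_0. now apply sinh_lt. Qed.

Lemma sinh_opp (x : R) : sinh (- x) = - sinh x.
Proof. unfold sinh. rewrite Ropp_involutive. field. Qed.

Lemma cosh_opp (x : R) : cosh (- x) = cosh x.
Proof. unfold cosh. rewrite Ropp_involutive. field. Qed.

Lemma sinh_neq_0 (x : R) : x <> 0 -> sinh x <> 0.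
Proof.
  intros H. destruct (Rlt_or_le 0 x) as [Hx|Hx].
  - pose proof (sinh_pos x Hx). lra.
  - assert (Hx' : 0 < - x) by lra. pose proof (sinh_pos _ Hx'). rewrite sinh_opp in *. lra.
Qed.

Lemma scaled_sinh_neq_0 (s : R) : s <> 0 -> sinh (sqrt 3 / 2 * s) <> 0.
Proof.
  intros Hs. apply sinh_neq_0. pose proof sqrt3_pos.
  apply Rmult_integral_contrapositive. split; lra.
Qed.

Lemma cosh_sqr (x : R) : cosh x ^ 2 = 1 + sinh x ^ 2.
Proof.
  unfold cosh, sinh. assert (E : exp x * exp (- x) = 1) by (rewrite <- exp_plus, Rplus_opp_r; apply exp_0).
  nra.
Qed.

Lemma p_fun_sqr (s : R) : s <> 0 ->
  p_fun s ^ 2 = 3 + 3 / sinh (sqrt 3 / 2 * s) ^ 2.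
Proof.
  intros Hs. pose proof (scaled_sinh_neq_0 s Hs) as H. unfold p_fun.
  transitivity ((sqrt 3 * sqrt 3) * cosh (sqrt 3 / 2 * s) ^ 2 / sinh (sqrt 3 / 2 * s) ^ 2);
    [field; auto|].
  rewrite sqrt3_sqr, cosh_sqr. field. auto.
Qed.

(** Source of all positivity below: H > 0, h > 1, and the denominators p^2 - 3 and p^2 - 1 do not
    vanish. *)
Lemma p_fun_sqr_gt (s : R) : s <> 0 -> 3 < p_fun s ^ 2.
Proof.
  intros Hs. rewrite p_fun_sqr by auto.
  pose proof (pow2_gt_0 _ (scaled_sinh_neq_0 s Hs)) as H.
  assert (0 < 3 / sinh (sqrt 3 / 2 * s) ^ 2) by (apply Rdiv_lt_0_compat; lra). lra.
Qed.

Lemma p_fun_is_derive (s : R) : s <> 0 ->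
  is_derive p_fun s ((p_fun s ^ 2 - 3) / 2).
Proof.
  intros Hs. pose proof (scaled_sinh_neq_0 s Hs) as H.
  unfold p_fun at 1. set (w := fun s => sqrt 3 / 2 * s).
  assert (Hw : is_derive w s (sqrt 3 / 2)).
  { unfold w. auto_derive; auto. ring. }
  evar_last.
  - apply (is_derive_scal (fun s => cosh (w s) / sinh (w s)) s (- sqrt 3)).
    apply is_derive_div; [| | exact H].
    + apply (is_derive_comp cosh w); [apply is_derive_Reals, derivable_pt_lim_cosh | exact Hw].
    + apply (is_derive_comp sinh w); [apply is_derive_Reals, derivable_pt_lim_sinh | exact Hw].
  - rewrite p_fun_sqr by auto.
    unfold scal, mult, w; simpl; unfold mult; simpl.
    set (x := sqrt 3 / 2 * s) in *.
    transitivity (- (sqrt 3 * sqrt 3 / 2) * ((sinh x ^ 2 - cosh x ^ 2) / sinh x ^ 2)).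
    + field; auto.
    + rewrite sqrt3_sqr, cosh_sqr. field. auto.
Qed.

Lemma p_fun_opp (s : R) : p_fun (- s) = - p_fun s.
Proof.
  unfold p_fun. replace (sqrt 3 / 2 * - s) with (- (sqrt 3 / 2 * s)) by ring.
  rewrite sinh_opp, cosh_opp. unfold Rdiv. rewrite Rinv_opp. ring.
Qed.

Lemma p_fun_neg (s : R) : 0 < s -> p_fun s < 0.
Proof.
  intros Hs. unfold p_fun. pose proof sqrt3_pos.
  assert (0 < sqrt 3 / 2 * s) by (apply Rmult_lt_0_compat; lra).
  assert (0 < cosh (sqrt 3 / 2 * s) / sinh (sqrt 3 / 2 * s)).
  { apply Rdiv_lt_0_compat; [apply cosh_pos | now apply sinh_pos]. }
  set (c := cosh _ / _) in *. assert (0 < sqrt 3 * c) by now apply Rmult_lt_0_compat. lra.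
Qed.

Lemma p_fun_surj_pos (l : R) : l < 0 -> 3 < l ^ 2 -> exists s, 0 < s /\ p_fun s = l.
Proof.
  intros Hl Hl2. pose proof sqrt3_pos as P. pose proof sqrt3_sqr as Q.
  set (y := - l / sqrt 3).
  assert (Hy : y * sqrt 3 = - l) by (unfold y; field; lra).
  assert (Y0 : 0 < y) by (apply Rdiv_lt_0_compat; lra).
  assert (Y2 : l ^ 2 = 3 * y ^ 2).
  { rewrite <- Q. replace l with (- (y * sqrt 3)) by lra. ring. }
  assert (Y1 : 1 < y) by nra.
  (* The inverse hyperbolic cotangent of y > 1, that is, exp(2 w) = (y + 1) / (y - 1). *)
  set (w := ln ((y + 1) / (y - 1)) / 2).
  assert (E1 : 1 < (y + 1) / (y - 1)).
  { apply (Rmult_lt_reg_r (y - 1)); [lra|]. field_simplify; lra. }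
  assert (W : 0 < w).
  { unfold w. rewrite <- ln_1. pose proof (ln_increasing 1 _ Rlt_0_1 E1). rewrite ln_1 in *. lra. }
  exists (2 / sqrt 3 * w). split.
  - apply Rmult_lt_0_compat; auto. apply Rdiv_lt_0_compat; lra.
  - unfold p_fun. replace (sqrt 3 / 2 * (2 / sqrt 3 * w)) with w by (field; lra).
    enough (E : cosh w / sinh w = y) by (rewrite E; nra).
    unfold cosh, sinh.
    assert (EE : exp w * exp w = (y + 1) / (y - 1)).
    { rewrite <- exp_plus. replace (w + w) with (ln ((y + 1) / (y - 1))) by (unfold w; field).
      apply exp_ln. lra. }
    assert (E0 : exp w * exp w * (y - 1) = y + 1) by (rewrite EE; field; lra).
    rewrite exp_Ropp. pose proof (exp_pos w).
    assert (exp w * exp w <> 1) by lra.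
    assert (exp w * exp w - 1 <> 0) by lra.
    transitivity ((exp w * exp w + 1) / (exp w * exp w - 1)).
    + field. repeat split; try lra. 
    + apply (Rmult_eq_reg_r (exp w * exp w - 1)); auto. field_simplify; auto. lra.
Qed.

(** A sign handles both half-planes in one argument: s -> - s exchanges them and [p_fun] is odd. *)
Definition component_sign (D : R -> R -> Prop) (sg : R) : Prop :=
  (sg = 1 \/ sg = - 1) /\ forall u v, D u v <-> 0 < sg * (u + v).

Lemma component_sign_ex (D : R -> R -> Prop) :
  is_component D -> exists sg, component_sign D sg.
Proof.
  intros [-> | ->]; [exists 1 | exists (- 1)]; split; auto;
    intros u v; unfold uv_domain_pos, uv_domain_neg; lra.
Qed.

Lemma p_fun_sign (sg s : R) : sg = 1 \/ sg = - 1 -> 0 < sg * s -> sg * p_fun s < 0.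
Proof.
  intros [-> | ->] Hs.
  - assert (H : 0 < s) by lra. pose proof (p_fun_neg s H). lra.
  - assert (H : 0 < - s) by lra. pose proof (p_fun_neg _ H). rewrite p_fun_opp in *. lra.
Qed.

Lemma p_fun_surj (sg l : R) :
  sg = 1 \/ sg = - 1 -> sg * l < 0 -> 3 < l ^ 2 -> exists s, 0 < sg * s /\ p_fun s = l.
Proof.
  intros [-> | ->] Hl Hl2.
  - destruct (p_fun_surj_pos l) as (s & Hs & E); auto; [lra|]. exists s. split; auto; lra.
  - destruct (p_fun_surj_pos (- l)) as (s & Hs & E); [lra | nra |].
    exists (- s). rewrite p_fun_opp. split; lra.
Qed.

(** * Explicit partial derivatives and the verification of both equations *)

Lemma h_sol_p_fun (u v : R) : uv_domain u v -> h_sol u v = (p_fun (u + v) ^ 2 - 1) / 2.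
Proof.
  intros H. unfold h_sol. rewrite p_fun_sqr by exact H.
  field. now apply scaled_sinh_neq_0.
Qed.

Lemma has_partials_ext D f g fu fv fuu fuv fvu fvv :
  open2 D -> (forall u v, D u v -> f u v = g u v) ->
  has_partials D f fu fv fuu fuv fvu fvv -> has_partials D g fu fv fuu fuv fvu fvv.
Proof.
  intros HO E Hp. split; try apply Hp.
  - intros u v Huv. apply (is_derive_D1_ext D _ f); auto. now apply (hp_u _ _ _ _ _ _ _ _ Hp).
  - intros u v Huv. apply (is_derive_D2_ext D _ f); auto. now apply (hp_v _ _ _ _ _ _ _ _ Hp).
  - intros u v Huv. destruct (hp_cont _ _ _ _ _ _ _ _ Hp u v Huv) as [C0 HC]. split; auto.
    now apply (continuity_2d_pt_ext_on D f).
Qed.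

Lemma continuity_2d_pt_sum (a : R -> R) (u v : R) :
  continuity_pt a (u + v) -> continuity_2d_pt (fun u v => a (u + v)) u v.
Proof.
  intros H. apply (continuity_1d_2d_pt_comp a (fun u v => u + v)); auto.
  apply continuity_2d_pt_plus; [apply continuity_2d_pt_id1 | apply continuity_2d_pt_id2].
Qed.

Lemma continuity_2d_pt_diff (a : R -> R) (u v : R) :
  continuity_pt a (u - v) -> continuity_2d_pt (fun u v => a (u - v)) u v.
Proof.
  intros H. apply (continuity_1d_2d_pt_comp a (fun u v => u - v)); auto.
  apply continuity_2d_pt_minus; [apply continuity_2d_pt_id1 | apply continuity_2d_pt_id2].
Qed.

Lemma continuity_2d_pt_fst (a : R -> R) (u v : R) :
  continuity_pt a u -> continuity_2d_pt (fun u v => a u) u v.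
Proof.
  intros H. apply (continuity_1d_2d_pt_comp a (fun u v => u)); auto. apply continuity_2d_pt_id1.
Qed.

(** With s = u + v and t = u - v, d/du is d/ds + d/dt and d/dv is d/ds - d/dt; the mixed derivative
    is therefore the wave operator a'' b - a b''. *)
Lemma product_partials (a a1 a2 b b1 b2 : R -> R) :
  (forall s, s <> 0 -> is_derive a s (a1 s)) ->
  (forall s, s <> 0 -> is_derive a1 s (a2 s)) ->
  (forall s, s <> 0 -> continuity_pt a2 s) ->
  (forall t, is_derive b t (b1 t)) -> (forall t, is_derive b1 t (b2 t)) ->
  (forall t, continuity_pt b2 t) ->
  has_partials uv_domain (fun u v => a (u + v) * b (u - v))
    (fun u v => a1 (u + v) * b (u - v) + a (u + v) * b1 (u - v))
    (fun u v => a1 (u + v) * b (u - v) - a (u + v) * b1 (u - v))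
    (fun u v => a2 (u + v) * b (u - v) + 2 * (a1 (u + v) * b1 (u - v)) + a (u + v) * b2 (u - v))
    (fun u v => a2 (u + v) * b (u - v) - a (u + v) * b2 (u - v))
    (fun u v => a2 (u + v) * b (u - v) - a (u + v) * b2 (u - v))
    (fun u v => a2 (u + v) * b (u - v) - 2 * (a1 (u + v) * b1 (u - v)) + a (u + v) * b2 (u - v)).
Proof.
  intros Ha Ha1 Ca2 Hb Hb1 Cb2.
  split; intros u v Huv;
    specialize (Ha _ Huv); specialize (Ha1 _ Huv); specialize (Ca2 _ Huv);
    specialize (Hb (u - v)); specialize (Hb1 (u - v)); specialize (Cb2 (u - v)).
  1-6: auto_derive;
    [ repeat split; eexists; eassumption
    | change (u + - v) with (u - v);
      change (Derive (fun s : R => a s)) with (Derive a); change (Derive (fun s : R => a1 s)) with (Derive a1);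
      change (Derive (fun s : R => b s)) with (Derive b); change (Derive (fun s : R => b1 s)) with (Derive b1);
      try rewrite (is_derive_unique _ _ _ Ha); try rewrite (is_derive_unique _ _ _ Ha1);
      try rewrite (is_derive_unique _ _ _ Hb); try rewrite (is_derive_unique _ _ _ Hb1); ring ].
  apply is_derive_continuity_pt in Ha, Ha1, Hb, Hb1.
  repeat split;
    repeat (apply continuity_2d_pt_plus || apply continuity_2d_pt_opp ||
            (apply continuity_2d_pt_sum; assumption) || (apply continuity_2d_pt_diff; assumption) ||
            apply continuity_2d_pt_mult || apply continuity_2d_pt_const).
Qed.

Lemma sum_partials (a a1 a2 : R -> R) :
  (forall s, s <> 0 -> is_derive a s (a1 s)) ->
  (forall s, s <> 0 -> is_derive a1 s (a2 s)) ->
  (forall s, s <> 0 -> continuity_pt a2 s) ->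
  has_partials uv_domain (fun u v => a (u + v))
    (fun u v => a1 (u + v)) (fun u v => a1 (u + v))
    (fun u v => a2 (u + v)) (fun u v => a2 (u + v))
    (fun u v => a2 (u + v)) (fun u v => a2 (u + v)).
Proof.
  intros Ha Ha1 Ca2.
  split; intros u v Huv;
    specialize (Ha _ Huv); specialize (Ha1 _ Huv); specialize (Ca2 _ Huv).
  1-6: auto_derive;
    [ repeat split; eexists; eassumption
    | change (Derive (fun s : R => a s)) with (Derive a); change (Derive (fun s : R => a1 s)) with (Derive a1);
      try rewrite (is_derive_unique _ _ _ Ha); try rewrite (is_derive_unique _ _ _ Ha1); ring ].
  apply is_derive_continuity_pt in Ha, Ha1.
  repeat split; apply continuity_2d_pt_sum; assumption.
Qed.

(** [auto_derive] leaves [Derive p_fun] symbolic; the Riccati equation p' = (p^2 - 3) / 2 replaces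
    it, and an identity in p remains. *)
Ltac derive_p Hs :=
  auto_derive;
  [ repeat split; try (eexists; exact (p_fun_is_derive _ Hs)); auto
  | change (Derive (fun s : R => p_fun s)) with (Derive p_fun);
    try rewrite (is_derive_unique _ _ _ (p_fun_is_derive _ Hs)) ].

Lemma h_sol_partials :
  has_partials uv_domain h_sol
    (fun u v => p_fun (u + v) * (p_fun (u + v) ^ 2 - 3) / 2)
    (fun u v => p_fun (u + v) * (p_fun (u + v) ^ 2 - 3) / 2)
    (fun u v => 3 * (p_fun (u + v) ^ 2 - 1) * (p_fun (u + v) ^ 2 - 3) / 4)
    (fun u v => 3 * (p_fun (u + v) ^ 2 - 1) * (p_fun (u + v) ^ 2 - 3) / 4)
    (fun u v => 3 * (p_fun (u + v) ^ 2 - 1) * (p_fun (u + v) ^ 2 - 3) / 4)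
    (fun u v => 3 * (p_fun (u + v) ^ 2 - 1) * (p_fun (u + v) ^ 2 - 3) / 4).
Proof.
  apply (has_partials_ext _ (fun u v => (p_fun (u + v) ^ 2 - 1) / 2)).
  - apply uv_domain_open.
  - intros u v Huv. now rewrite h_sol_p_fun.
  - apply (sum_partials (fun s => (p_fun s ^ 2 - 1) / 2) (fun s => p_fun s * (p_fun s ^ 2 - 3) / 2)
      (fun s => 3 * (p_fun s ^ 2 - 1) * (p_fun s ^ 2 - 3) / 4)); intros s Hs.
    + derive_p Hs. field.
    + derive_p Hs. field.
    (* Continuity of the second derivative follows from its differentiability; the value of the
       third derivative is left to unification. *)
    + eapply is_derive_continuity_pt. derive_p Hs. reflexivity.
Qed.

Definition H_sol (u v : R) : R := h_sol u v - 1.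

Lemma H_sol_partials :
  has_partials uv_domain H_sol
    (fun u v => p_fun (u + v) * (p_fun (u + v) ^ 2 - 3) / 2)
    (fun u v => p_fun (u + v) * (p_fun (u + v) ^ 2 - 3) / 2)
    (fun u v => 3 * (p_fun (u + v) ^ 2 - 1) * (p_fun (u + v) ^ 2 - 3) / 4)
    (fun u v => 3 * (p_fun (u + v) ^ 2 - 1) * (p_fun (u + v) ^ 2 - 3) / 4)
    (fun u v => 3 * (p_fun (u + v) ^ 2 - 1) * (p_fun (u + v) ^ 2 - 3) / 4)
    (fun u v => 3 * (p_fun (u + v) ^ 2 - 1) * (p_fun (u + v) ^ 2 - 3) / 4).
Proof.
  apply (has_partials_ext _ (fun u v => (p_fun (u + v) ^ 2 - 3) / 2)).
  - apply uv_domain_open.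
  - intros u v Huv. unfold H_sol. rewrite h_sol_p_fun by auto. field.
  - apply (sum_partials (fun s => (p_fun s ^ 2 - 3) / 2) (fun s => p_fun s * (p_fun s ^ 2 - 3) / 2)
      (fun s => 3 * (p_fun s ^ 2 - 1) * (p_fun s ^ 2 - 3) / 4)); intros s Hs.
    + derive_p Hs. field.
    + derive_p Hs. field.
    + eapply is_derive_continuity_pt. derive_p Hs. reflexivity.
Qed.

Lemma titeica_PDE_h_sol : titeica_PDE uv_domain h_sol.
Proof.
  split; [exact (has_partials_C2_on _ _ _ _ _ _ _ _ uv_domain_open h_sol_partials)|].
  intros u v Huv. pose proof (p_fun_sqr_gt _ Huv) as Hp. split.
  - rewrite h_sol_p_fun by auto. lra.
  - assert (Q : forall s, s <> 0 -> p_fun s ^ 2 - 1 <> 0) by (intros s Hs; pose proof (p_fun_sqr_gt s Hs); lra).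
    (* The second derivative is already written as h - 1 / h^2, since h = (p^2 - 1) / 2. *)
    assert (HP : has_partials uv_domain (fun u v => ln (h_sol u v))
      (fun u v => p_fun (u + v) * (p_fun (u + v) ^ 2 - 3) / (p_fun (u + v) ^ 2 - 1))
      (fun u v => p_fun (u + v) * (p_fun (u + v) ^ 2 - 3) / (p_fun (u + v) ^ 2 - 1))
      (fun u v => (p_fun (u + v) ^ 2 - 1) / 2 - 4 / (p_fun (u + v) ^ 2 - 1) ^ 2)
      (fun u v => (p_fun (u + v) ^ 2 - 1) / 2 - 4 / (p_fun (u + v) ^ 2 - 1) ^ 2)
      (fun u v => (p_fun (u + v) ^ 2 - 1) / 2 - 4 / (p_fun (u + v) ^ 2 - 1) ^ 2)
      (fun u v => (p_fun (u + v) ^ 2 - 1) / 2 - 4 / (p_fun (u + v) ^ 2 - 1) ^ 2)).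
    { apply (has_partials_ext _ (fun u v => ln ((p_fun (u + v) ^ 2 - 1) / 2))).
      - apply uv_domain_open.
      - intros x y Hxy. now rewrite h_sol_p_fun.
      - apply (sum_partials (fun s => ln ((p_fun s ^ 2 - 1) / 2)) (fun s => p_fun s * (p_fun s ^ 2 - 3) / (p_fun s ^ 2 - 1))
          (fun s => (p_fun s ^ 2 - 1) / 2 - 4 / (p_fun s ^ 2 - 1) ^ 2)); intros s Hs;
        pose proof (p_fun_sqr_gt s Hs) as Hg; pose proof (Q s Hs) as Hq.
        + derive_p Hs; [lra|]. field. lra.
        + derive_p Hs. field. lra.
        + eapply is_derive_continuity_pt. derive_p Hs. reflexivity. }
    rewrite (has_partials_D12 _ _ _ _ _ _ _ _ u v uv_domain_open HP Huv).
    rewrite h_sol_p_fun by auto. field. apply Q, Huv.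
Qed.

Lemma liouville_titeica_PDE_H_sol : liouville_titeica_PDE uv_domain H_sol.
Proof.
  split; [exact (has_partials_C2_on _ _ _ _ _ _ _ _ uv_domain_open H_sol_partials)|].
  intros u v Huv. pose proof (p_fun_sqr_gt _ Huv) as Hp. split.
  - unfold H_sol. rewrite h_sol_p_fun by auto. lra.
  - assert (HP : has_partials uv_domain (fun u v => ln (H_sol u v))
      (fun u v => p_fun (u + v)) (fun u v => p_fun (u + v))
      (fun u v => (p_fun (u + v) ^ 2 - 3) / 2) (fun u v => (p_fun (u + v) ^ 2 - 3) / 2)
      (fun u v => (p_fun (u + v) ^ 2 - 3) / 2) (fun u v => (p_fun (u + v) ^ 2 - 3) / 2)).
    { apply (has_partials_ext _ (fun u v => ln ((p_fun (u + v) ^ 2 - 3) / 2))).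
      - apply uv_domain_open.
      - intros x y Hxy. unfold H_sol. rewrite h_sol_p_fun by auto. f_equal. field.
      - apply (sum_partials (fun s => ln ((p_fun s ^ 2 - 3) / 2)) p_fun
          (fun s => (p_fun s ^ 2 - 3) / 2)); intros s Hs;
        pose proof (p_fun_sqr_gt s Hs) as Hg.
        + derive_p Hs; [lra|]. field. lra.
        + now apply p_fun_is_derive.
        + eapply is_derive_continuity_pt. derive_p Hs; reflexivity. }
    rewrite (has_partials_D12 _ _ _ _ _ _ _ _ u v uv_domain_open HP Huv).
    unfold H_sol. rewrite h_sol_p_fun by auto. field.
Qed.

(** * The surface of revolution *)

(** For r = a(s) b(t), the terms in b' of the r_uu equation give a'/a = (h' - 1) / (2 h) = (p - 2)
    (p + 1) / (2 (p - 1)), which integrates to this function. *)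
Definition radius (s : R) : R := exp (- s / 2) * (p_fun s - 1).
Definition radius1 (s : R) : R := exp (- s / 2) * (p_fun s - 2) * (p_fun s + 1) / 2.
(** The factor is h - 3/4: r_uv = h r reads a'' b - a b'' = h a b, with b'' = - (3/4) b. *)
Definition radius2 (s : R) : R := (p_fun s ^ 2 / 2 - 5 / 4) * radius s.
(** For r = g(s) the system says g'' = h g and g'' = (h' + 1) / h g'. Hence g'/g = h^2 / (h' + 1) =
    (p + 1)^2 / (2 (p + 2)), which integrates to this function. *)
Definition height (s : R) : R := exp s * (p_fun s + 2).
Definition height1 (s : R) : R := exp s * (p_fun s + 1) ^ 2 / 2.
Definition height2 (s : R) : R := (p_fun s ^ 2 - 1) / 2 * height s.

Definition revolution_surface (u v : R) : vec3 :=
  Vec3 (radius (u + v) * cos (sqrt 3 / 2 * (u - v)))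
       (radius (u + v) * sin (sqrt 3 / 2 * (u - v)))
       (height (u + v)).

Lemma radius_is_derive (s : R) : s <> 0 -> is_derive radius s (radius1 s).
Proof. intros Hs. unfold radius, radius1. derive_p Hs. unfold Rdiv; field. Qed.

Lemma radius1_is_derive (s : R) : s <> 0 -> is_derive radius1 s (radius2 s).
Proof. intros Hs. unfold radius1, radius2, radius. derive_p Hs. unfold Rdiv; field. Qed.

Lemma height_is_derive (s : R) : s <> 0 -> is_derive height s (height1 s).
Proof. intros Hs. unfold height, height1. derive_p Hs. field. Qed.

Lemma height1_is_derive (s : R) : s <> 0 -> is_derive height1 s (height2 s).
Proof. intros Hs. unfold height1, height2, height. derive_p Hs. field. Qed.

Lemma radius2_continuity (s : R) : s <> 0 -> continuity_pt radius2 s.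
Proof.
  intros Hs. eapply is_derive_continuity_pt. unfold radius2, radius. derive_p Hs. reflexivity.
Qed.

Lemma height2_continuity (s : R) : s <> 0 -> continuity_pt height2 s.
Proof.
  intros Hs. eapply is_derive_continuity_pt. unfold height2, height. derive_p Hs. reflexivity.
Qed.

Lemma cos_scaled_is_derive (k t : R) : is_derive (fun t => cos (k * t)) t (- k * sin (k * t)).
Proof. auto_derive; auto. ring. Qed.

Lemma sin_scaled_is_derive (k t : R) : is_derive (fun t => sin (k * t)) t (k * cos (k * t)).
Proof. auto_derive; auto. ring. Qed.

Lemma half_sqrt3_sqr : sqrt 3 / 2 * (sqrt 3 / 2) = 3 / 4.
Proof. pose proof sqrt3_sqr. lra. Qed.

Lemma cos_second_derive (t : R) :
  is_derive (fun t => - (sqrt 3 / 2) * sin (sqrt 3 / 2 * t)) t (- (3 / 4) * cos (sqrt 3 / 2 * t)).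
Proof.
  auto_derive; auto. rewrite <- half_sqrt3_sqr. field.
Qed.

Lemma sin_second_derive (t : R) :
  is_derive (fun t => sqrt 3 / 2 * cos (sqrt 3 / 2 * t)) t (- (3 / 4) * sin (sqrt 3 / 2 * t)).
Proof.
  auto_derive; auto. rewrite <- half_sqrt3_sqr. field.
Qed.

Lemma rotating_partials (b b1 : R -> R) :
  (forall t, is_derive b t (b1 t)) -> (forall t, is_derive b1 t (- (3 / 4) * b t)) ->
  has_partials uv_domain (fun u v => radius (u + v) * b (u - v))
    (fun u v => radius1 (u + v) * b (u - v) + radius (u + v) * b1 (u - v))
    (fun u v => radius1 (u + v) * b (u - v) - radius (u + v) * b1 (u - v))
    (fun u v => radius2 (u + v) * b (u - v) + 2 * (radius1 (u + v) * b1 (u - v))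
                + radius (u + v) * (- (3 / 4) * b (u - v)))
    (fun u v => radius2 (u + v) * b (u - v) - radius (u + v) * (- (3 / 4) * b (u - v)))
    (fun u v => radius2 (u + v) * b (u - v) - radius (u + v) * (- (3 / 4) * b (u - v)))
    (fun u v => radius2 (u + v) * b (u - v) - 2 * (radius1 (u + v) * b1 (u - v))
                + radius (u + v) * (- (3 / 4) * b (u - v))).
Proof.
  intros Hb Hb1.
  apply (product_partials radius radius1 radius2 b b1 (fun t => - (3 / 4) * b t)); auto.
  - apply radius_is_derive.
  - apply radius1_is_derive.
  - apply radius2_continuity.
  - intros t. eapply is_derive_continuity_pt. apply is_derive_scal, Hb.
Qed.

(** Cosine and sine are treated together. The eigenvalue is forced: if b'' = - k b, the three
    equations give h - 2 k = (h'^2 - 1) / (2 h^2) = (p^2 - 4) / 2 = h - 3/2, so k = 3/4. *)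
Lemma rotating_system (b b1 : R -> R) :
  (forall t, is_derive b t (b1 t)) -> (forall t, is_derive b1 t (- (3 / 4) * b t)) ->
  titeica_system uv_domain h_sol (fun u v => radius (u + v) * b (u - v)).
Proof.
  intros Hb Hb1. assert (HP := rotating_partials b b1 Hb Hb1).
  split; [exact (has_partials_C2_on _ _ _ _ _ _ _ _ uv_domain_open HP)|].
  intros u v Huv.
  rewrite (has_partials_D11 _ _ _ _ _ _ _ _ u v uv_domain_open HP Huv).
  rewrite (has_partials_D12 _ _ _ _ _ _ _ _ u v uv_domain_open HP Huv).
  rewrite (has_partials_D22 _ _ _ _ _ _ _ _ u v uv_domain_open HP Huv).
  rewrite (has_partials_D1 _ _ _ _ _ _ _ _ u v HP Huv).
  rewrite (has_partials_D2 _ _ _ _ _ _ _ _ u v HP Huv).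
  rewrite (has_partials_D1 _ _ _ _ _ _ _ _ u v h_sol_partials Huv).
  rewrite (has_partials_D2 _ _ _ _ _ _ _ _ u v h_sol_partials Huv).
  rewrite h_sol_p_fun by auto.
  pose proof (p_fun_sqr_gt _ Huv) as Hp.
  unfold radius2, radius1, radius.
  repeat split; field; lra.
Qed.

Definition height_partials :=
  sum_partials height height1 height2 height_is_derive height1_is_derive height2_continuity.

Lemma height_system : titeica_system uv_domain h_sol (fun u v => height (u + v)).
Proof.
  assert (HP := height_partials).
  split; [exact (has_partials_C2_on _ _ _ _ _ _ _ _ uv_domain_open HP)|].
  intros u v Huv.
  rewrite (has_partials_D11 _ _ _ _ _ _ _ _ u v uv_domain_open HP Huv).
  rewrite (has_partials_D12 _ _ _ _ _ _ _ _ u v uv_domain_open HP Huv).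
  rewrite (has_partials_D22 _ _ _ _ _ _ _ _ u v uv_domain_open HP Huv).
  rewrite (has_partials_D1 _ _ _ _ _ _ _ _ u v HP Huv).
  rewrite (has_partials_D2 _ _ _ _ _ _ _ _ u v HP Huv).
  rewrite (has_partials_D1 _ _ _ _ _ _ _ _ u v h_sol_partials Huv).
  rewrite (has_partials_D2 _ _ _ _ _ _ _ _ u v h_sol_partials Huv).
  rewrite h_sol_p_fun by auto.
  pose proof (p_fun_sqr_gt _ Huv) as Hp.
  unfold height2, height1, height.
  repeat split; field; lra.
Qed.

Lemma revolution_x_system : titeica_system uv_domain h_sol (coord_x revolution_surface).
Proof.
  exact (rotating_system _ _ (cos_scaled_is_derive (sqrt 3 / 2)) cos_second_derive).
Qed.

Lemma revolution_y_system : titeica_system uv_domain h_sol (coord_y revolution_surface).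
Proof.
  exact (rotating_system _ _ (sin_scaled_is_derive (sqrt 3 / 2)) sin_second_derive).
Qed.

Lemma revolution_wronskian (u v : R) :
  uv_domain u v ->
  wronskian (coord_x revolution_surface) (coord_y revolution_surface)
    (coord_z revolution_surface) u v = 3 * sqrt 3 * h_sol u v.
Proof.
  intros Huv. unfold wronskian.
  assert (Px := rotating_partials _ _ (cos_scaled_is_derive (sqrt 3 / 2)) cos_second_derive).
  assert (Py := rotating_partials _ _ (sin_scaled_is_derive (sqrt 3 / 2)) sin_second_derive).
  assert (Pz := height_partials).
  change (coord_x revolution_surface) with (fun u v => radius (u + v) * cos (sqrt 3 / 2 * (u - v))).
  change (coord_y revolution_surface) with (fun u v => radius (u + v) * sin (sqrt 3 / 2 * (u - v))).
  change (coord_z revolution_surface) with (fun u v => height (u + v)).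
  rewrite (has_partials_D1 _ _ _ _ _ _ _ _ u v Px Huv), (has_partials_D2 _ _ _ _ _ _ _ _ u v Px Huv).
  rewrite (has_partials_D1 _ _ _ _ _ _ _ _ u v Py Huv), (has_partials_D2 _ _ _ _ _ _ _ _ u v Py Huv).
  rewrite (has_partials_D1 _ _ _ _ _ _ _ _ u v Pz Huv), (has_partials_D2 _ _ _ _ _ _ _ _ u v Pz Huv).
  rewrite h_sol_p_fun by auto.
  assert (Trig := sin2_cos2 (sqrt 3 / 2 * (u - v))). unfold Rsqr in Trig.
  set (C := cos _) in *. set (S := sin _) in *.
  (* The angle enters only through S^2 + C^2. In what remains the exponentials cancel, and the
     constant is sqrt 3, from the angular derivative, times (p^2 - 1) - (p^2 - 4) = 3. *)
  transitivity (sqrt 3 * (S * S + C * C) * radius (u + v) *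
     (radius (u + v) * height1 (u + v) - radius1 (u + v) * height (u + v))).
  - unfold det3, dot, cross; simpl. field.
  - rewrite Trig. unfold radius, radius1, height, height1.
    set (p := p_fun (u + v)).
    assert (E : exp (- (u + v) / 2) * exp (- (u + v) / 2) * exp (u + v) = 1).
    { rewrite <- !exp_plus, <- exp_0. f_equal. field. }
    transitivity (3 * sqrt 3 * ((p ^ 2 - 1) / 2) *
      (exp (- (u + v) / 2) * exp (- (u + v) / 2) * exp (u + v))); [field | rewrite E; ring].
Qed.

Lemma h_sol_neq_0 (u v : R) : uv_domain u v -> h_sol u v <> 0.
Proof. intros Huv. pose proof (p_fun_sqr_gt _ Huv). rewrite h_sol_p_fun by auto. lra. Qed.

Lemma titeica_system_sub (D D' : R -> R -> Prop) (h x : R -> R -> R) :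
  (forall u v, D u v -> D' u v) -> titeica_system D' h x -> titeica_system D h x.
Proof. intros H [C0 S]. split; [now apply (C2_on_sub D D') | auto]. Qed.

Lemma revolution_defined_by (D : R -> R -> Prop) :
  is_component D -> defined_by D h_sol revolution_surface.
Proof.
  intros HD.
  assert (HS : forall u v, D u v -> uv_domain u v) by (intros u v; now apply component_uv_domain).
  split; [|split; [|split]].
  - apply (titeica_system_sub _ _ _ _ HS), revolution_x_system.
  - apply (titeica_system_sub _ _ _ _ HS), revolution_y_system.
  - apply (titeica_system_sub _ _ _ _ HS), height_system.
  - destruct (component_inhabited D HD) as [v Huv].
    apply (wronskian_neq_0_lin_indep D _ _ _ 0 v); auto using component_open.
    + apply (C2_on_sub D _ _ HS), revolution_x_system.
    + apply (C2_on_sub D _ _ HS), revolution_y_system.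
    + apply (C2_on_sub D _ _ HS), height_system.
    + rewrite revolution_wronskian by auto. pose proof sqrt3_pos.
      apply Rmult_integral_contrapositive. split; [lra | apply h_sol_neq_0; auto].
Qed.

Lemma titeica_wronskian (D : R -> R -> Prop) (r : R -> R -> vec3) :
  is_component D -> defined_by D h_sol r ->
  exists c, c <> 0 /\ forall u v, D u v ->
    wronskian (coord_x r) (coord_y r) (coord_z r) u v = c * h_sol u v.
Proof.
  intros HD (Sx & Sy & Sz & HI).
  destruct (revolution_defined_by D HD) as (RX & RY & RZ & _).
  assert (HS : forall u v, D u v -> uv_domain u v) by (intros u v; now apply component_uv_domain).
  pose proof sqrt3_pos.
  eapply (independent_wronskian D h_sol (fun u v => 1 / h_sol u v) (fun u v => 1 / h_sol u v)
     (coord_x revolution_surface) (coord_y revolution_surface) (coord_z revolution_surface) _ _ _ (3 * sqrt 3)); auto.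
  - apply (C2_on_sub D _ _ HS), titeica_PDE_h_sol.
  - intros u v Huv. now apply h_sol_neq_0, HS.
  - lra.
  - intros u v Huv. now apply revolution_wronskian, HS.
Qed.

Lemma defined_by_titeica_surface (D : R -> R -> Prop) (r : R -> R -> vec3) :
  is_component D -> defined_by D h_sol r -> titeica_surface D r.
Proof.
  intros HD Hr. destruct (titeica_wronskian D r HD Hr) as (c & Hc & HW).
  destruct Hr as (Sx & Sy & Sz & _).
  apply (frame_system_titeica_surface D h_sol _ _ r c) with (2 := Sx) (3 := Sy) (4 := Sz); auto.
  intros u v Huv. apply h_sol_neq_0. now apply (component_uv_domain D).
Qed.

Lemma defined_by_centroaffine (D : R -> R -> Prop) (r r' : R -> R -> vec3) :
  is_component D -> defined_by D h_sol r -> defined_by D h_sol r' ->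
  centroaffine_equivalent D r r'.
Proof.
  intros HD Hr Hr'. destruct (titeica_wronskian D r HD Hr) as (c & Hc & HW).
  destruct (titeica_wronskian D r' HD Hr') as (c' & Hc' & HW').
  assert (HS : forall u v, D u v -> uv_domain u v) by (intros u v; now apply component_uv_domain).
  destruct Hr as (Sx & Sy & Sz & _), Hr' as (Sx' & Sy' & Sz' & _).
  apply (frame_system_centroaffine D h_sol (fun u v => 1 / h_sol u v) (fun u v => 1 / h_sol u v) r r' c c'); auto.
  - apply (C2_on_sub D _ _ HS), titeica_PDE_h_sol.
  - intros u v Huv. now apply h_sol_neq_0, HS.
Qed.

Lemma half_line (sg : R) : sg = 1 \/ sg = - 1 ->
  exists a b, Rbar_lt a b /\ forall s, itv a b s <-> 0 < sg * s.
Proof.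
  intros [-> | ->]; [exists 0, p_infty | exists m_infty, 0]; unfold itv; simpl; split; auto;
    intros s; lra.
Qed.

Lemma itv_locally (a b : Rbar) (s : R) : itv a b s -> locally s (itv a b).
Proof.
  intros [Ha Hb]. apply filter_and.
  - exact (open_Rbar_gt a s Ha).
  - exact (open_Rbar_lt b s Hb).
Qed.

Lemma C1_on_itv_intro (a b : Rbar) (f f1 : R -> R) :
  (forall s, itv a b s -> is_derive f s (f1 s)) ->
  (forall s, itv a b s -> continuity_pt f1 s) -> C1_on_itv a b f.
Proof.
  intros Hf Hc s Hs. split; [eexists; now apply Hf|].
  apply (continuous_ext_loc _ f1).
  - generalize (itv_locally a b s Hs). apply filter_imp. intros x Hx.
    symmetry. now apply is_derive_unique, Hf.
  - apply continuity_pt_filterlim. now apply Hc.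
Qed.

Lemma C2_on_itv_intro (a b : Rbar) (f f1 f2 : R -> R) :
  (forall s, itv a b s -> is_derive f s (f1 s)) ->
  (forall s, itv a b s -> is_derive f1 s (f2 s)) ->
  (forall s, itv a b s -> continuity_pt f2 s) -> C2_on_itv a b f.
Proof.
  intros Hf Hf1 Hc. split.
  - apply (C1_on_itv_intro _ _ _ f1); auto.
    intros s Hs. eapply is_derive_continuity_pt. now apply Hf1.
  - apply (C1_on_itv_intro _ _ _ f2); auto.
    intros s Hs. apply (is_derive_ext_loc f1); auto.
    generalize (itv_locally a b s Hs). apply filter_imp. intros x Hx.
    symmetry. now apply is_derive_unique, Hf.
Qed.

Lemma revolution_surface_of_revolution (D : R -> R -> Prop) :
  is_component D -> surface_of_revolution D revolution_surface.
Proof.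
  intros HD. destruct (component_sign_ex D HD) as (sg & Hsg & HDs).
  destruct (half_line sg Hsg) as (a & b & Hab & Hitv).
  assert (Sg2 : sg * sg = 1) by (destruct Hsg; subst; ring).
  assert (Hne : forall s, itv a b s -> s <> 0).
  { intros s Hs E. apply Hitv in Hs. subst. lra. }
  (* [sg * radius s < 0], so the profile is [- sg * radius] and the frame is
     turned accordingly. *)
  exists (Vec3 0 0 0), (Vec3 (- sg) 0 0), (Vec3 0 (- sg) 0), (Vec3 0 0 1), a, b,
    (fun s => - sg * radius s), height.
  split; [|split; [exact Hab|split; [|split; [|split]]]].
  - unfold orthonormal, dot; simpl. repeat split; lra.
  - apply (C2_on_itv_intro _ _ _ (fun s => - sg * radius1 s) (fun s => - sg * radius2 s)).
    + intros s Hs. apply is_derive_scal, radius_is_derive; auto.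
    + intros s Hs. apply is_derive_scal, radius1_is_derive; auto.
    + intros s Hs. apply (continuity_pt_scal radius2). apply radius2_continuity; auto.
  - apply (C2_on_itv_intro _ _ _ height1 height2).
    + intros s Hs. apply height_is_derive; auto.
    + intros s Hs. apply height1_is_derive; auto.
    + intros s Hs. apply height2_continuity; auto.
  - intros s Hs. assert (Hs0 := Hne s Hs). apply Hitv in Hs.
    pose proof (p_fun_sqr_gt s Hs0) as Hp. pose proof (p_fun_sign sg s Hsg Hs) as Hps.
    split.
    + unfold radius. replace (- sg * (exp (- s / 2) * (p_fun s - 1)))
        with (exp (- s / 2) * (- sg * (p_fun s - 1))) by ring.
      apply Rmult_lt_0_compat; [apply exp_pos|]. destruct Hsg; subst; nra.
    (* The height alone makes the profile regular: its derivative vanishes only for p = - 1,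
       excluded by p^2 > 3. *)
    + right. rewrite (is_derive_unique _ _ _ (height_is_derive s Hs0)). unfold height1.
      pose proof (exp_pos s). assert (0 < (p_fun s + 1) ^ 2) by (apply pow2_gt_0; nra).
      assert (0 < exp s * (p_fun s + 1) ^ 2) by now apply Rmult_lt_0_compat. lra.
  - pose proof sqrt3_pos as H3.
    intros p. unfold image, revolution_surface, vadd, vscal; simpl. split.
    + intros (u & v & Huv & ->). exists (u + v), (sqrt 3 / 2 * (u - v)). split.
      * apply Hitv. now apply HDs.
      * f_equal; [| |ring].
        -- transitivity (sg * sg * (radius (u + v) * cos (sqrt 3 / 2 * (u - v)))); [rewrite Sg2|]; ring.
        -- transitivity (sg * sg * (radius (u + v) * sin (sqrt 3 / 2 * (u - v)))); [rewrite Sg2|]; ring.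
    + intros (s & th & Hs & ->).
      (* Solution of u + v = s and sqrt 3 / 2 (u - v) = th. The angle is unrestricted, since u - v
         is free on a half-plane. *)
      exists ((s + 2 / sqrt 3 * th) / 2), ((s - 2 / sqrt 3 * th) / 2).
      replace ((s + 2 / sqrt 3 * th) / 2 + (s - 2 / sqrt 3 * th) / 2) with s by (field; lra).
      replace (sqrt 3 / 2 * ((s + 2 / sqrt 3 * th) / 2 - (s - 2 / sqrt 3 * th) / 2)) with th by (field; lra).
      split.
      * apply HDs. apply Hitv in Hs.
        replace ((s + 2 / sqrt 3 * th) / 2 + (s - 2 / sqrt 3 * th) / 2) with s by (field; lra). exact Hs.
      * f_equal; [| |ring].
        -- transitivity (sg * sg * (radius s * cos th)); [|rewrite Sg2]; ring.
        -- transitivity (sg * sg * (radius s * sin th)); [|rewrite Sg2]; ring.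
Qed.

(** * The ruled surfaces *)

(** The r_vv equation says that r_v / H depends on u only, so r_v = H A(u); as H = p_v, integration
    gives r = B(u) + p A(u). Then r_uv = H r together with H_u = p H forces B = A'. *)
Definition ruled_solution (A B : R -> R) (u v : R) : R := B u + p_fun (u + v) * A u.

Lemma H_sol_p_fun (u v : R) : uv_domain u v -> H_sol u v = (p_fun (u + v) ^ 2 - 3) / 2.
Proof. intros Huv. unfold H_sol. rewrite h_sol_p_fun by auto. field. Qed.

Lemma H_sol_neq_0 (u v : R) : uv_domain u v -> H_sol u v <> 0.
Proof. intros Huv. pose proof (p_fun_sqr_gt _ Huv). rewrite H_sol_p_fun by auto. lra. Qed.

Lemma ruled_solution_partials (phi A B C : R -> R) :
  (forall u, continuous phi u) ->
  (forall t, is_derive A t (B t)) -> (forall t, is_derive B t (C t)) ->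
  (forall t, is_derive C t (3 * B t + phi t * A t)) ->
  let p := fun u v => p_fun (u + v) in
  has_partials uv_domain (ruled_solution A B)
    (fun u v => C u + (p u v ^ 2 - 3) / 2 * A u + p u v * B u)
    (fun u v => (p u v ^ 2 - 3) / 2 * A u)
    (fun u v => 3 * B u + phi u * A u + p u v * ((p u v ^ 2 - 3) / 2) * A u
                + (p u v ^ 2 - 3) * B u + p u v * C u)
    (fun u v => (p u v ^ 2 - 3) / 2 * (B u + p u v * A u))
    (fun u v => (p u v ^ 2 - 3) / 2 * (B u + p u v * A u))
    (fun u v => p u v * ((p u v ^ 2 - 3) / 2) * A u).
Proof.
  intros Hphi HA HB HC p. unfold ruled_solution, p.
  split; intros u v Huv; specialize (HA u); specialize (HB u); specialize (HC u);
    pose proof (p_fun_is_derive _ Huv) as Hp.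
  1-6: auto_derive;
    [ repeat split; eexists; eassumption
    | change (Derive (fun s : R => A s)) with (Derive A); change (Derive (fun s : R => B s)) with (Derive B);
      change (Derive (fun s : R => C s)) with (Derive C); change (Derive (fun s : R => p_fun s)) with (Derive p_fun);
      try rewrite (is_derive_unique _ _ _ HA); try rewrite (is_derive_unique _ _ _ HB);
      try rewrite (is_derive_unique _ _ _ HC); try rewrite (is_derive_unique _ _ _ Hp); field ].
  assert (Cp := continuity_2d_pt_sum _ _ _ (is_derive_continuity_pt _ _ _ Hp)).
  assert (CA := continuity_2d_pt_fst _ u v (is_derive_continuity_pt _ _ _ HA)).
  assert (CB := continuity_2d_pt_fst _ u v (is_derive_continuity_pt _ _ _ HB)).
  assert (CC := continuity_2d_pt_fst _ u v (is_derive_continuity_pt _ _ _ HC)).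
  assert (Cphi : continuity_2d_pt (fun u v => phi u) u v).
  { apply continuity_2d_pt_fst. apply continuity_pt_filterlim. apply Hphi. }
  repeat split; unfold pow, Rdiv;
    repeat (assumption || apply continuity_2d_pt_plus || apply continuity_2d_pt_minus ||
            apply continuity_2d_pt_mult || apply continuity_2d_pt_const).
Qed.

(** In the r_uu equation the terms in B compare 2 H B, plus the contribution of C', with p^2 B; the
    coefficient 3 of the third order equation is p^2 - 2 H. *)
Lemma ruled_solution_system (phi A B C : R -> R) :
  (forall u, continuous phi u) ->
  (forall t, is_derive A t (B t)) -> (forall t, is_derive B t (C t)) ->
  (forall t, is_derive C t (3 * B t + phi t * A t)) ->
  ruled_titeica_system uv_domain phi H_sol (ruled_solution A B).
Proof.
  intros Hphi HA HB HC. assert (HP := ruled_solution_partials phi A B C Hphi HA HB HC).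
  cbv beta zeta in HP.
  split; [exact (has_partials_C2_on _ _ _ _ _ _ _ _ uv_domain_open HP)|].
  intros u v Huv.
  rewrite (has_partials_D11 _ _ _ _ _ _ _ _ u v uv_domain_open HP Huv).
  rewrite (has_partials_D12 _ _ _ _ _ _ _ _ u v uv_domain_open HP Huv).
  rewrite (has_partials_D22 _ _ _ _ _ _ _ _ u v uv_domain_open HP Huv).
  rewrite (has_partials_D1 _ _ _ _ _ _ _ _ u v HP Huv).
  rewrite (has_partials_D2 _ _ _ _ _ _ _ _ u v HP Huv).
  rewrite (has_partials_D1 _ _ _ _ _ _ _ _ u v H_sol_partials Huv).
  rewrite (has_partials_D2 _ _ _ _ _ _ _ _ u v H_sol_partials Huv).
  rewrite H_sol_p_fun by auto.
  pose proof (p_fun_sqr_gt _ Huv) as Hp. unfold ruled_solution.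
  repeat split; field; lra.
Qed.

(** The initial data of (A, B, C) at u = 0 are the canonical basis, so on the line u = 0 the
    Wronskian is H itself. Both components meet this line, and [wronskian_const] spreads the value
    over each of them. *)
Lemma ruled_basis (phi : R -> R) :
  (forall u, continuous phi u) ->
  exists A1 A2 A3 B1 B2 B3 C1 C2 C3 : R -> R,
    (forall t, is_derive A1 t (B1 t) /\ is_derive A2 t (B2 t) /\ is_derive A3 t (B3 t) /\
       is_derive B1 t (C1 t) /\ is_derive B2 t (C2 t) /\ is_derive B3 t (C3 t)) /\
    (forall t, continuity_pt C1 t /\ continuity_pt C2 t /\ continuity_pt C3 t) /\
    ruled_titeica_system uv_domain phi H_sol (ruled_solution A1 B1) /\
    ruled_titeica_system uv_domain phi H_sol (ruled_solution A2 B2) /\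
    ruled_titeica_system uv_domain phi H_sol (ruled_solution A3 B3) /\
    forall v, uv_domain 0 v ->
      wronskian (ruled_solution A1 B1) (ruled_solution A2 B2) (ruled_solution A3 B3) 0 v
      = H_sol 0 v.
Proof.
  intros Hphi.
  destruct (third_order_ode_solution phi 1 0 0 Hphi) as (A1 & B1 & C1 & X1 & X2 & X3 & X4 & X5 & X6).
  destruct (third_order_ode_solution phi 0 1 0 Hphi) as (A2 & B2 & C2 & Y1 & Y2 & Y3 & Y4 & Y5 & Y6).
  destruct (third_order_ode_solution phi 0 0 1 Hphi) as (A3 & B3 & C3 & Z1 & Z2 & Z3 & Z4 & Z5 & Z6).
  exists A1, A2, A3, B1, B2, B3, C1, C2, C3.
  split; [|split; [|split; [|split; [|split]]]].
  - intros t. auto 10.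
  - intros t. repeat split; eapply is_derive_continuity_pt; eauto.
  - now apply (ruled_solution_system phi A1 B1 C1).
  - now apply (ruled_solution_system phi A2 B2 C2).
  - now apply (ruled_solution_system phi A3 B3 C3).
  - intros v Hv. unfold wronskian.
    assert (P1 := ruled_solution_partials phi A1 B1 C1 Hphi X1 X2 X3).
    assert (P2 := ruled_solution_partials phi A2 B2 C2 Hphi Y1 Y2 Y3).
    assert (P3 := ruled_solution_partials phi A3 B3 C3 Hphi Z1 Z2 Z3).
    cbv beta zeta in P1, P2, P3.
    rewrite (has_partials_D1 _ _ _ _ _ _ _ _ 0 v P1 Hv), (has_partials_D2 _ _ _ _ _ _ _ _ 0 v P1 Hv).
    rewrite (has_partials_D1 _ _ _ _ _ _ _ _ 0 v P2 Hv), (has_partials_D2 _ _ _ _ _ _ _ _ 0 v P2 Hv).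
    rewrite (has_partials_D1 _ _ _ _ _ _ _ _ 0 v P3 Hv), (has_partials_D2 _ _ _ _ _ _ _ _ 0 v P3 Hv).
    rewrite H_sol_p_fun by auto. unfold ruled_solution.
    rewrite X4, X5, X6, Y4, Y5, Y6, Z4, Z5, Z6.
    unfold det3, dot, cross; simpl. field.
Qed.

Lemma ruled_titeica_system_sub (D D' : R -> R -> Prop) phi (h x : R -> R -> R) :
  (forall u v, D u v -> D' u v) -> ruled_titeica_system D' phi h x -> ruled_titeica_system D phi h x.
Proof. intros H [C0 S]. split; [now apply (C2_on_sub D D') | auto]. Qed.

Lemma ruled_basis_wronskian (D : R -> R -> Prop) (phi : R -> R) (X Y Z : R -> R -> R) :
  is_component D ->
  ruled_titeica_system uv_domain phi H_sol X -> ruled_titeica_system uv_domain phi H_sol Y ->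
  ruled_titeica_system uv_domain phi H_sol Z ->
  (forall v, uv_domain 0 v -> wronskian X Y Z 0 v = H_sol 0 v) ->
  forall u v, D u v -> wronskian X Y Z u v = 1 * H_sol u v.
Proof.
  intros HD SX SY SZ HW.
  assert (HS : forall u v, D u v -> uv_domain u v) by (intros u v; now apply component_uv_domain).
  assert (HSys := fun x Hx =>
    ruled_titeica_system_frame _ _ _ _ (ruled_titeica_system_sub D uv_domain phi H_sol x HS Hx)).
  destruct (wronskian_const D H_sol (fun u v => phi u / H_sol u v) (fun _ _ => 0) X Y Z) as [c Hc]; auto.
  - apply (C2_on_sub D _ _ HS), liouville_titeica_PDE_H_sol.
  - intros u v Huv. now apply H_sol_neq_0, HS.
  - destruct (component_inhabited D HD) as [v0 Hv0].
    assert (Hn := H_sol_neq_0 0 v0 (HS _ _ Hv0)).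
    specialize (HW v0 (HS _ _ Hv0)). rewrite (Hc 0 v0 Hv0) in HW.
    replace 1 with c; [exact Hc|].
    apply (Rmult_eq_reg_r (H_sol 0 v0)); auto. lra.
Qed.

Lemma ruled_existence (D : R -> R -> Prop) (phi : R -> R) :
  is_component D -> (forall u, continuous phi u) ->
  exists r, ruled_defined_by D phi H_sol r.
Proof.
  intros HD Hphi.
  destruct (ruled_basis phi Hphi)
    as (A1 & A2 & A3 & B1 & B2 & B3 & C1 & C2 & C3 & _ & _ & S1 & S2 & S3 & HW).
  assert (HS : forall u v, D u v -> uv_domain u v) by (intros u v; now apply component_uv_domain).
  exists (fun u v => Vec3 (ruled_solution A1 B1 u v) (ruled_solution A2 B2 u v) (ruled_solution A3 B3 u v)).
  split; [|split; [|split]].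
  - apply (ruled_titeica_system_sub _ _ _ _ _ HS), S1.
  - apply (ruled_titeica_system_sub _ _ _ _ _ HS), S2.
  - apply (ruled_titeica_system_sub _ _ _ _ _ HS), S3.
  - destruct (component_inhabited D HD) as [v Hv].
    apply (wronskian_neq_0_lin_indep D _ _ _ 0 v); auto using component_open.
    + apply (C2_on_sub D _ _ HS), S1.
    + apply (C2_on_sub D _ _ HS), S2.
    + apply (C2_on_sub D _ _ HS), S3.
    + change (wronskian (ruled_solution A1 B1) (ruled_solution A2 B2) (ruled_solution A3 B3) 0 v <> 0).
      rewrite HW by auto. apply H_sol_neq_0; auto.
Qed.

(** The range of [p_fun] on a component, a half-line ending at sqrt 3 or - sqrt 3. It is the same
    for every u, so all rulings share it as parameter interval. *)
Lemma ruling_interval (sg : R) : sg = 1 \/ sg = - 1 ->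
  exists c d, Rbar_lt c d /\ forall l, itv c d l <-> sg * l < 0 /\ 3 < l ^ 2.
Proof.
  pose proof sqrt3_pos as P. pose proof sqrt3_sqr as Q.
  intros [-> | ->]; [exists m_infty, (- sqrt 3) | exists (sqrt 3), p_infty];
    unfold itv; simpl; split; auto; intros l; split; intros H; repeat split; nra.
Qed.

Lemma is_derive_lin3 (f g h : R -> R) (a b c t f' g' h' : R) :
  is_derive f t f' -> is_derive g t g' -> is_derive h t h' ->
  is_derive (fun s => a * f s + b * g s + c * h s) t (a * f' + b * g' + c * h').
Proof.
  intros Hf Hg Hh.
  apply (is_derive_plus (fun s => a * f s + b * g s) (fun s => c * h s)).
  - apply (is_derive_plus (fun s => a * f s) (fun s => b * g s)); now apply is_derive_scal.
  - now apply is_derive_scal.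
Qed.

Lemma continuity_pt_lin3 (f g h : R -> R) (a b c t : R) :
  continuity_pt f t -> continuity_pt g t -> continuity_pt h t ->
  continuity_pt (fun s => a * f s + b * g s + c * h s) t.
Proof.
  intros Hf Hg Hh.
  apply (continuity_pt_plus (fun s => a * f s + b * g s) (fun s => c * h s)).
  - apply (continuity_pt_plus (fun s => a * f s) (fun s => b * g s)); now apply continuity_pt_scal.
  - now apply continuity_pt_scal.
Qed.

Lemma D2_ruled_solution (A B : R -> R) (u v : R) :
  uv_domain u v -> D2 (ruled_solution A B) u v = (p_fun (u + v) ^ 2 - 3) / 2 * A u.
Proof.
  intros Huv. apply is_derive_unique. unfold ruled_solution.
  derive_p Huv. field.
Qed.

Lemma ruled_combination (a b c : R) (A1 A2 A3 B1 B2 B3 : R -> R) (u v : R) :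
  a * ruled_solution A1 B1 u v + b * ruled_solution A2 B2 u v + c * ruled_solution A3 B3 u v
  = ruled_solution (fun t => a * A1 t + b * A2 t + c * A3 t)
                   (fun t => a * B1 t + b * B2 t + c * B3 t) u v.
Proof. unfold ruled_solution. ring. Qed.

Lemma ruled_defined_by_surface (D : R -> R -> Prop) (phi : R -> R) (r : R -> R -> vec3) :
  is_component D -> (forall u, continuous phi u) -> ruled_defined_by D phi H_sol r ->
  titeica_surface D r /\ ruled_surface D r.
Proof.
  intros HD Hphi (Sx & Sy & Sz & HI).
  destruct (ruled_basis phi Hphi)
    as (A1 & A2 & A3 & B1 & B2 & B3 & C1 & C2 & C3 & HDer & HC3 & S1 & S2 & S3 & HW0).
  assert (HS : forall u v, D u v -> uv_domain u v) by (intros u v; now apply component_uv_domain).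
  assert (HW := ruled_basis_wronskian D phi _ _ _ HD S1 S2 S3 HW0).
  assert (Ch : C2_on D H_sol) by apply (C2_on_sub D _ _ HS), liouville_titeica_PDE_H_sol.
  assert (Hn : forall u v, D u v -> H_sol u v <> 0) by (intros u v Huv; now apply H_sol_neq_0, HS).
  apply (ruled_titeica_system_sub D _ _ _ _ HS) in S1, S2, S3.
  apply ruled_titeica_system_frame in S1, S2, S3, Sx, Sy, Sz.
  assert (HC := fun x Hx => solution_combination D H_sol _ _ _ _ _ x 1 HD Ch Hn S1 S2 S3 R1_neq_R0 HW Hx).
  destruct (independent_wronskian D H_sol _ _ _ _ _ _ _ _ 1 HD Ch Hn S1 S2 S3 R1_neq_R0 HW Sx Sy Sz HI)
    as (k & Hk & HWr).
  split; [now apply (frame_system_titeica_surface D H_sol _ _ r k) with (2 := Sx)|].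
  destruct (HC _ Sx) as (a1 & b1 & c1 & E1), (HC _ Sy) as (a2 & b2 & c2 & E2), (HC _ Sz) as (a3 & b3 & c3 & E3).
  destruct (component_sign_ex D HD) as (sg & Hsg & HDs).
  destruct (ruling_interval sg Hsg) as (c & d & Hcd & Hitv).
  (* The part of r free of p is the base curve [al], the coefficient of p is the direction [w], and
     p itself is the parameter along the ruling. *)
  set (al := fun t => Vec3 (a1 * B1 t + b1 * B2 t + c1 * B3 t) (a2 * B1 t + b2 * B2 t + c2 * B3 t)
     (a3 * B1 t + b3 * B2 t + c3 * B3 t)).
  set (w := fun t => Vec3 (a1 * A1 t + b1 * A2 t + c1 * A3 t) (a2 * A1 t + b2 * A2 t + c2 * A3 t)
     (a3 * A1 t + b3 * A2 t + c3 * A3 t)).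
  assert (Hr : forall u v, D u v -> r u v = vadd (al u) (vscal (p_fun (u + v)) (w u))).
  { intros u v Huv.
    destruct (E1 u v Huv) as (F1 & _), (E2 u v Huv) as (F2 & _), (E3 u v Huv) as (F3 & _).
    rewrite ruled_combination in F1, F2, F3.
    apply vec3_ext; [exact F1 | exact F2 | exact F3]. }
  exists m_infty, p_infty, c, d, al, w.
  split; [exact I|]. split; [exact Hcd|].
  assert (HB : forall a b c, C1_on_itv m_infty p_infty (fun t => a * B1 t + b * B2 t + c * B3 t)).
  { intros a b e.
    apply (C1_on_itv_intro _ _ _ (fun t => a * C1 t + b * C2 t + e * C3 t)).
    - intros t _. apply is_derive_lin3; apply HDer.
    - intros t _. apply continuity_pt_lin3; apply HC3. }
  assert (HA : forall a b c, C1_on_itv m_infty p_infty (fun t => a * A1 t + b * A2 t + c * A3 t)).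
  { intros a b e.
    apply (C1_on_itv_intro _ _ _ (fun t => a * B1 t + b * B2 t + e * B3 t)).
    - intros t _. apply is_derive_lin3; apply HDer.
    - intros t _. destruct (HDer t) as (_ & _ & _ & d1 & d2 & d3).
      apply is_derive_continuity_pt in d1, d2, d3. now apply continuity_pt_lin3. }
  split; [apply HB|]. split; [apply HB|]. split; [apply HB|].
  split; [apply HA|]. split; [apply HA|]. split; [apply HA|].
  split.
  - (* If [w t = 0] then [r_v] vanishes along [u = t], and so does the Wronskian. *)
    intros t _ Hw. injection Hw as W1 W2 W3.
    assert (Htv : exists v, D t v).
    { exists (sg - t). apply HDs. destruct Hsg; subst; lra. }
    destruct Htv as [v Htv].
    assert (Htv' := HS t v Htv).
    destruct (E1 t v Htv) as (_ & _ & F1), (E2 t v Htv) as (_ & _ & F2), (E3 t v Htv) as (_ & _ & F3).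
    rewrite !D2_ruled_solution in F1, F2, F3 by auto.
    set (q := (p_fun (t + v) ^ 2 - 3) / 2) in *.
    assert (G1 : D2 (coord_x r) t v = 0).
    { rewrite F1. transitivity (q * (a1 * A1 t + b1 * A2 t + c1 * A3 t)); [ring|].
      rewrite W1. ring. }
    assert (G2 : D2 (coord_y r) t v = 0).
    { rewrite F2. transitivity (q * (a2 * A1 t + b2 * A2 t + c2 * A3 t)); [ring|].
      rewrite W2. ring. }
    assert (G3 : D2 (coord_z r) t v = 0).
    { rewrite F3. transitivity (q * (a3 * A1 t + b3 * A2 t + c3 * A3 t)); [ring|].
      rewrite W3. ring. }
    assert (HW' := HWr t v Htv). unfold wronskian in HW'. rewrite G1, G2, G3 in HW'.
    apply (Rmult_integral_contrapositive _ _ (conj Hk (Hn t v Htv))).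
    rewrite <- HW'. unfold det3, dot, cross; simpl. ring.
  - intros p. split.
    + intros (u & v & Huv & ->). exists u, (p_fun (u + v)).
      split; [split; exact I|]. split; [|now apply Hr].
      apply Hitv. split.
      * apply p_fun_sign; auto. now apply HDs.
      * apply p_fun_sqr_gt, (HS u v Huv).
    + intros (t & l & _ & Hl & ->). apply Hitv in Hl. destruct Hl as [Hl1 Hl2].
      (* The parameter l is p(s) for some s in the half-line of the component, and v = s - t reaches
         this s on the ruling u = t. *)
      destruct (p_fun_surj sg l Hsg Hl1 Hl2) as (s & Hs & <-).
      assert (Huv : D t (s - t)).
      { apply HDs. replace (t + (s - t)) with s by ring. exact Hs. }
      exists t, (s - t). split; auto.
      rewrite Hr by auto. replace (t + (s - t)) with s by ring. reflexivity.
Qed.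

Theorem proposition1 :
  (titeica_PDE uv_domain h_sol /\
   forall D : R -> R -> Prop, is_component D ->
     (forall r : R -> R -> vec3, defined_by D h_sol r -> titeica_surface D r) /\
     (forall r r' : R -> R -> vec3,
        defined_by D h_sol r -> defined_by D h_sol r' ->
        centroaffine_equivalent D r r') /\
     (exists r : R -> R -> vec3,
        defined_by D h_sol r /\ titeica_surface D r /\ surface_of_revolution D r))
  /\
  (liouville_titeica_PDE uv_domain (fun u v => h_sol u v - 1) /\
   forall D : R -> R -> Prop, is_component D ->
   forall phi : R -> R, (forall u : R, continuous phi u) ->
     (exists r : R -> R -> vec3,
        ruled_defined_by D phi (fun u v => h_sol u v - 1) r) /\
     (forall r : R -> R -> vec3,
        ruled_defined_by D phi (fun u v => h_sol u v - 1) r ->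
        titeica_surface D r /\ ruled_surface D r)).
Proof.
  split; split.
  - exact titeica_PDE_h_sol.
  - intros D HD. split; [|split].
    + intros r. now apply defined_by_titeica_surface.
    + intros r r'. now apply defined_by_centroaffine.
    + exists revolution_surface.
      assert (Hr := revolution_defined_by D HD).
      split; [exact Hr|]. split.
      * now apply defined_by_titeica_surface.
      * now apply revolution_surface_of_revolution.
  (* [H_sol] and [fun u v => h_sol u v - 1] agree by conversion, here and below. *)
  - exact liouville_titeica_PDE_H_sol.
  - intros D HD phi Hphi. split.
    + exact (ruled_existence D phi HD Hphi).
    + intros r Hr. exact (ruled_defined_by_surface D phi r HD Hphi Hr).
Qed.
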